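(* Let $\mathcal{G}$ be a finite simplicial graph with at least $3$ vertices, and let $C(\mathcal{G})$ be the right-angled Coxeter group associated to $\mathcal{G}$. Then every infinite-index convex-cocompact subgroup of $C(\mathcal{G})$ is $(\mathcal{A}\cup\mathcal{S})$-separable if and only if the complement graph $\mathcal{G}^c$ is connected.
   Context: $\mathcal{G}^c$ is the graph on the same vertex set as $\mathcal{G}$ in which two distinct vertices are adjacent iff they are not adjacent in $\mathcal{G}$. The right-angled Coxeter group associated to a simplicial graph $\mathcal{G}$ with vertex set $I$ is $C(\mathcal{G})=\langle s_i,\ i\in I \mid s_i^2=1 \text{ for } i\in I,\ [s_i,s_j]=1 \text{ for } \{i,j\}\in E(\mathcal{G})\rangle$. The Davis--Moussong complex $DM(\mathcal{G})$ is the cube complex with vertex set $C(\mathcal{G})$, with an edge labelled $s$ joining $g$ and $gs$ for each $g\in C(\mathcal{G})$ and each generator $s$, and, for each $g$ and each set of distinct pairwise commuting generators $s_{i_1},\dots,s_{i_n}$, one $n$-cube with vertex set $\{g\prod_{j\in P}s_{i_j} : P\subset\{1,\dots,n\}\}$ (a cube is determined by its vertex set). $C(\mathcal{G})$ acts on it by left multiplication. A subcomplex $Y$ of a cube complex $X$ is convex if every geodesic of the 1-skeleton $X^{(1)}$ (edge-path metric) with endpoints in $Y$ is contained in $Y$. A subgroup $H$ of $C(\mathcal{G})$ is convex-cocompact if there is a non-empty convex subcomplex $Y\subset DM(\mathcal{G})$ that is invariant under $H$ and on which $H$ acts cocompactly. For a class $\mathcal{C}$ of groups, a subgroup $H$ of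 a finitely generated group $G$ is $\mathcal{C}$-separable (in $G$) if for any finite set $\{\gamma_1,\dots,\gamma_m\}\subset G\setminus H$ there is a surjective homomorphism $f$ from $G$ onto a group in $\mathcal{C}$ such that $f(\gamma_i)\notin f(H)$ for all $i$. $\mathcal{A}$ denotes the class of finite alternating groups and $\mathcal{S}$ the class of finite symmetric groups; so $(\mathcal{A}\cup\mathcal{S})$-separable means that the quotient is required to be either a finite alternating or a finite symmetric group.
   Formalization: The graph is additionally assumed not to be complete: for a complete graph on at least 3 vertices the Coxeter group is finite, so the separability condition holds vacuously while the complement graph is disconnected, and the stated equivalence fails. *)

(* Defs.v *)
From HB Require Import structures.
From mathcomp Require Import all_boot all_fingroup.
From mathcomp Require Import alt.
From mathcomp Require Import boolp classical_sets functions cardinality.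

Set Implicit Arguments.
Unset Strict Implicit.
Unset Printing Implicit Defensive.

Local Open Scope classical_set_scope.
Local Open Scope group_scope.

(* Groups given by generators and relators. The letter (x, false) stands for
   the generator x and (x, true) for its formal inverse; a word is a sequence
   of letters, and a word r in R gives the relation r = 1. *)

Definition letter_inv (X : Type) (a : X * bool) : X * bool := (a.1, ~~ a.2).

Definition word_inv (X : Type) (w : seq (X * bool)) : seq (X * bool) :=
  rev (map (@letter_inv X) w).

Inductive word_eq (X : Type) (R : set (seq (X * bool))) :
    seq (X * bool) -> seq (X * bool) -> Prop :=
| WordRefl w : word_eq R w w
| WordSym v w : word_eq R v w -> word_eq R w v
| WordTrans u v w : word_eq R u v -> word_eq R v w -> word_eq R u w
| WordCat v v' w w' :
    word_eq R v v' -> word_eq R w w' -> word_eq R (v ++ w) (v' ++ w')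
| WordCancel a : word_eq R [:: a; letter_inv a] [::]
| WordRel r : R r -> word_eq R r [::].

Section Presentation.
Variables (X : choiceType) (R : set (seq (X * bool))).
Implicit Types u v w : seq (X * bool).

Definition word_eqb : rel (seq (X * bool)) := fun v w => `[< word_eq R v w >].

Lemma word_eqb_refl : reflexive word_eqb.
Proof. by move=> w; apply/asboolP; apply: WordRefl. Qed.

Lemma word_eqb_sym : symmetric word_eqb.
Proof. by move=> v w; apply/asboolP/asboolP; apply: WordSym. Qed.

Lemma word_eqb_trans : transitive word_eqb.
Proof.
move=> v u w /asboolP uv /asboolP vw; apply/asboolP; exact: WordTrans uv vw.
Qed.

Canonical word_equiv := EquivRel word_eqb word_eqb_refl word_eqb_sym
  word_eqb_trans.

Definition presented : Type := {eq_quot word_equiv}%qT.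
HB.instance Definition _ := Choice.copy presented {eq_quot word_equiv}%qT.

Definition word_class w : presented := (\pi_{eq_quot word_equiv} w)%qT.
Definition word_repr (g : presented) : seq (X * bool) :=
  generic_quotient.repr (g : {eq_quot word_equiv}%qT).

Lemma word_reprK g : word_class (word_repr g) = g.
Proof. exact: reprK. Qed.

Lemma word_classP v w : word_class v = word_class w <-> word_eq R v w.
Proof.
split; first by move/eqquotP/asboolP.
by move=> vw; apply/eqquotP; apply/asboolP.
Qed.

Lemma word_reprP w : word_eq R (word_repr (word_class w)) w.
Proof. by apply/word_classP; rewrite word_reprK. Qed.

Lemma word_inv_cat v w : word_inv (v ++ w) = word_inv w ++ word_inv v.
Proof. by rewrite /word_inv map_cat rev_cat. Qed.

Lemma word_invK : involutive (@word_inv X).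
Proof.
move=> w; rewrite /word_inv map_rev revK -map_comp map_id_in //.
by case=> x b _; rewrite /= /letter_inv /= negbK.
Qed.

Lemma word_eq_catV w : word_eq R (w ++ word_inv w) [::].
Proof.
elim: w => [|a w IHw]; first exact: WordRefl.
rewrite -cat1s word_inv_cat -catA (catA w).
apply: (WordTrans _ (WordCancel R a)); apply: WordCat (WordRefl _ _) _.
rewrite -[[:: letter_inv a]]cat0s; exact: WordCat IHw (WordRefl _ _).
Qed.

Lemma word_eq_Vcat w : word_eq R (word_inv w ++ w) [::].
Proof. by rewrite -{2}[w]word_invK; apply: word_eq_catV. Qed.

Lemma word_eq_inv v w : word_eq R v w -> word_eq R (word_inv v) (word_inv w).
Proof.
move=> vw; apply: (@WordTrans _ _ _ (word_inv v ++ (w ++ word_inv w))).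
  rewrite -{1}[word_inv v]cats0; apply: WordCat (WordRefl _ _) _.
  exact: WordSym (word_eq_catV w).
rewrite catA -{2}[word_inv w]cat0s; apply: WordCat (WordRefl _ _).
apply: WordTrans (word_eq_Vcat v).
exact: WordCat (WordRefl _ _) (WordSym vw).
Qed.

Definition presented_one : presented := word_class [::].
Definition presented_mul (g h : presented) : presented :=
  word_class (word_repr g ++ word_repr h).
Definition presented_inv (g : presented) : presented :=
  word_class (word_inv (word_repr g)).

Lemma presented_mulE v w :
  presented_mul (word_class v) (word_class w) = word_class (v ++ w).
Proof. by apply/word_classP; apply: WordCat; apply: word_reprP. Qed.

Lemma presented_invE w : presented_inv (word_class w) = word_class (word_inv w).
Proof. by apply/word_classP/word_eq_inv/word_reprP. Qed.

Lemma presented_mulA : associative presented_mul.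
Proof.
move=> f g h; rewrite -[f]word_reprK -[g]word_reprK -[h]word_reprK.
by rewrite !presented_mulE catA.
Qed.

Lemma presented_mul1 : left_id presented_one presented_mul.
Proof. by move=> g; rewrite -[g]word_reprK presented_mulE. Qed.

Lemma presented_mulr1 : right_id presented_one presented_mul.
Proof. by move=> g; rewrite -[g]word_reprK presented_mulE cats0. Qed.

Lemma presented_mulV : left_inverse presented_one presented_inv presented_mul.
Proof.
move=> g; rewrite -[g]word_reprK presented_invE presented_mulE.
exact/word_classP/word_eq_Vcat.
Qed.

Lemma presented_mulrV : right_inverse presented_one presented_inv presented_mul.
Proof.
move=> g; rewrite -[g]word_reprK presented_invE presented_mulE.
exact/word_classP/word_eq_catV.
Qed.

HB.instance Definition _ := isGroup.Build presented presented_mulA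
  presented_mul1 presented_mulr1 presented_mulV presented_mulrV.

Definition pres_gen (x : X) : presented := word_class [:: (x, false)].

End Presentation.

(* A finite simplicial graph is a symmetric irreflexive relation e on a
   finite type I. *)

Definition complement_graph (I : finType) (e : rel I) : rel I :=
  fun i j => (i != j) && ~~ e i j.

Definition graph_connected (I : finType) (e : rel I) : Prop :=
  forall i j : I, connect e i j.

Section Coxeter.
Variables (I : finType) (e : rel I).

Definition racg_relators : set (seq (I * bool)) :=
  [set r | (exists i, r = [:: (i, false); (i, false)]) \/
           (exists i j, e i j /\
              r = [:: (i, true); (j, true); (i, false); (j, false)])].

Definition racg : groupType := presented racg_relators.

Definition racg_gen (i : I) : racg := pres_gen racg_relators i.

Definition commuting_gens (J : {set I}) : Prop :=
  forall i j, i \in J -> j \in J -> commute (racg_gen i) (racg_gen j).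

(* The order of the factors is irrelevant when J consists of commuting
   generators. *)
Definition cube_vertices (g : racg) (J : {set I}) : set racg :=
  [set g * \prod_(j in P) racg_gen j | P in [set P : {set I} | P \subset J]].

(* Cubes are identified with their vertex sets; J of cardinality 0 and 1 gives
   the vertices and the edges. *)
Definition davis_moussong : set (set racg) :=
  [set c | exists (g : racg) (J : {set I}),
             commuting_gens J /\ c = cube_vertices g J].

End Coxeter.

Arguments davis_moussong {I} e _ : rename.

(* Cube complexes in which a cube is determined by its vertex set, given as the
   family K of the vertex sets of their cubes. The faces of a cube c are the
   members of K contained in c. *)
Section CubeComplex.
Variables (V : choiceType) (K : set (set V)).

Definition subcomplex (Y : set (set V)) : Prop :=
  Y `<=` K /\ forall c d, Y c -> K d -> d `<=` c -> Y d.

Definition skel_edge : rel V := fun x y => `[< x <> y /\ K [set x; y] >].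

(* The edge path x :: p from x to last x p has size p edges. *)
Definition geodesic (x : V) (p : seq V) : Prop :=
  path skel_edge x p /\
  forall q, path skel_edge x q -> last x q = last x p -> (size p <= size q)%N.

Definition path_in (Y : set (set V)) (x : V) (p : seq V) : Prop :=
  Y [set x] /\ path (fun y z => `[< Y [set y; z] >]) x p.

Definition convex_subcomplex (Y : set (set V)) : Prop :=
  subcomplex Y /\
  forall x p, geodesic x p -> Y [set x] -> Y [set last x p] -> path_in Y x p.

End CubeComplex.

Definition is_subgroup (G : groupType) (H : set G) : Prop :=
  H 1 /\ forall x y, H x -> H y -> H (x * y^-1).

Definition translate (G : groupType) (g : G) (c : set G) : set G :=
  [set g * x | x in c].

Definition invariant_under (G : groupType) (H : set G) (Y : set (set G)) :=
  forall h c, H h -> Y c -> Y (translate h c).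

(* A subcomplex is compact if and only if it has finitely many cubes, and every
   compact subset of a cube complex lies in a finite subcomplex. *)
Definition cocompact_on (G : groupType) (K : set (set G)) (H : set G)
    (Y : set (set G)) : Prop :=
  exists Z : set (set G),
    [/\ subcomplex K Z, finite_set Z, Z `<=` Y &
        forall c, Y c -> exists h d, [/\ H h, Z d & c = translate h d]].

Definition convex_cocompact (I : finType) (e : rel I) (H : set (racg e)) :=
  exists Y : set (set (racg e)),
    [/\ Y !=set0, convex_subcomplex (davis_moussong e) Y, invariant_under H Y &
        cocompact_on (davis_moussong e) H Y].

Definition infinite_index (G : groupType) (H : set G) : Prop :=
  infinite_set [set translate g H | g in [set: G]].

Definition alternating_group (Q : groupType) : Prop :=
  exists (n : nat) (f : {multiplicative Q -> {perm 'I_n}}),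
    injective f /\ range f = [set s | s \in 'Alt_('I_n)].

Definition symmetric_group (Q : groupType) : Prop :=
  exists (n : nat) (f : {multiplicative Q -> {perm 'I_n}}),
    injective f /\ range f = [set s | s \in 'Sym_('I_n)].

Definition separable (C : groupType -> Prop) (G : groupType) (H : set G) : Prop :=
  forall F : set G, finite_set F -> F `<=` ~` H ->
    exists (Q : groupType) (f : {multiplicative G -> Q}),
      [/\ C Q, range f = [set: Q] & forall g, F g -> ~ (f @` H) (f g)].

(* Main.v *)
Require Import Defs.
From HB Require Import structures.
From mathcomp Require Import all_boot all_fingroup.
From mathcomp Require Import ssralg zmodp gseries alt.
From mathcomp Require Import boolp classical_sets functions cardinality.

(** If the complement graph is disconnected, some nontrivial generator s_k
    commutes with an infinite dihedral subgroup generated by s_a and s_b, where a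
    lies in another component. In a large alternating or symmetric quotient the
    generators of the component of a generate a normal subgroup, which contains
    the alternating group by simplicity; s_k centralizes it, hence dies. So s_k
    and the first powers of s_a s_b cannot be separated from the trivial subgroup.

    If the complement graph is connected, let H act on the convex subcomplex Y. The
    finite quotient H\Y is a piece of the Schreier graph of H; letting a generator
    fix the points at which it has no edge makes it a permutation representation,
    because Y contains the fourth vertex of a square as soon as it contains three.
    A missing edge labelled u at a point x0 can always be added: double the orbit
    of x0 under the generators commuting with u. This keeps the graph finite, and
    it is used three times: to make paths to the elements to be separated, so that
    their images leave the stabilizer of the base point; along a walk in the
    complement graph through all vertices, to reach a point with only one edge;
    and from there, to grow a long tail labelled t, u, t, u, ... . A suitable
    power of s_t s_u is a single cycle along the tail, filling more than half of
    the points, and its commutator with the last generator of the walk is a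
    3-cycle. Hence the image contains the alternating group. *)

Set Implicit Arguments.
Unset Strict Implicit.
Unset Printing Implicit Defensive.

Local Open Scope group_scope.

(** * Permutation groups containing a 3-cycle *)

Section Tricycles.
Context {X : finType} (G : {group {perm X}}).
Implicit Types (x y z v : X) (g s : {perm X}).

(** Products apply the left factor first, so for distinct points this is the cycle sending [x] to
    [y], [y] to [z] and [z] to [x]. *)
Definition tricycle x y z : {perm X} := tperm x y * tperm x z.

Lemma tricycleJ x y z g : tricycle x y z ^ g = tricycle (g x) (g y) (g z).
Proof. by rewrite /tricycle conjMg !tpermJ. Qed.

Lemma tricycleV x y z : (tricycle x y z)^-1 = tricycle x z y.
Proof. by rewrite /tricycle invMg !tpermV. Qed.

Lemma tricycle_rot x y z :
  x != z -> y != z -> tricycle x y z = tricycle y z x.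
Proof.
move=> xz yz; rewrite /tricycle conjgCV tpermJ tpermV tpermL tpermD //.
by rewrite (tpermC x y).
Qed.

(** An equivalence relation invariant under [G]. Once it has a single class, [G] contains the
    alternating group. *)
Definition linked x y : bool :=
  (x == y) || [exists z, [&& x != y, x != z, y != z & tricycle x y z \in G]].

Lemma linkedP x y : reflect
  (x = y \/ exists z, [/\ x != y, x != z, y != z & tricycle x y z \in G])
  (linked x y).
Proof.
apply: (iffP orP) => [[/eqP->|/fintype.existsP[z /and4P[? ? ? ?]]]|[->|[z [? ? ? ?]]]].
- by left.
- by right; exists z.
- by left.
- by right; apply/fintype.existsP; exists z; apply/and4P.
Qed.

Lemma linked_refl x : linked x x.
Proof. by apply/linkedP; left. Qed.

Lemma linked_sym x y : linked x y -> linked y x.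
Proof.
case/linkedP=> [->|[z [xy xz yz Gt]]]; first exact: linked_refl.
apply/linkedP; right; exists z; split=> //; first by rewrite eq_sym.
have <- : tricycle x z y = tricycle y x z.
  by rewrite -tricycle_rot //; rewrite eq_sym.
by rewrite -tricycleV groupV.
Qed.

Lemma linkedJ x y g : g \in G -> linked x y -> linked (g x) (g y).
Proof.
move=> Gg /linkedP[->|[z [xy xz yz Gt]]]; first exact: linked_refl.
apply/linkedP; right; exists (g z); split; rewrite ?(inj_eq perm_inj) //.
by rewrite -tricycleJ groupJ.
Qed.

Lemma tricycle1 x y z : x != y -> y != z -> tricycle x y z x = y.
Proof. by move=> xy yz; rewrite permM tpermL tpermD // 1?eq_sym. Qed.

Lemma tricycle2 x y z : tricycle x y z y = z.
Proof. by rewrite permM tpermR tpermL. Qed.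

Lemma tricycle3 x y z : x != z -> y != z -> tricycle x y z z = x.
Proof. by move=> xz yz; rewrite permM (tpermD xz yz) tpermR. Qed.

Lemma tricycleD x y z v :
  x != v -> y != v -> z != v -> tricycle x y z v = v.
Proof. by move=> xv yv zv; rewrite permM !tpermD. Qed.

(** A 3-cycle sending [y] to [v] and fixing [x] carries a link from [x] to [y] onto one from [x] to
    [v]. If [x] is its third point, the cycle itself links [x] and [v]. *)
Lemma linked_trans x y v : linked x y -> linked y v -> linked x v.
Proof.
move=> xy_l yv_l; case/linkedP: (yv_l) => [<- //|[w [yv yw vw Gt]]].
have [->|xv] := eqVneq x v; first exact: linked_refl.
have [xw|xw] := eqVneq x w.
  subst w; apply: linked_sym; apply/linkedP; right; exists y.
  split=> //; try by rewrite eq_sym.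
  by rewrite -tricycle_rot.
have [-> //|xy] := eqVneq x y.
by have := linkedJ Gt xy_l; rewrite tricycle1 // tricycleD // eq_sym.
Qed.

(** Conjugating the cycle on [x], [y], [z] by the one on [z], [v], [w] replaces [z] by [v]. If [w]
    is [x] or [y], that point moves too, and conjugating once more gives the inverse of the wanted
    cycle. *)
Lemma mem_tricycle x y v :
  (forall x y, linked x y) -> x != y -> x != v -> y != v -> tricycle x y v \in G.
Proof.
move=> all_l xy xv yv.
have [z [_ xz yz Gt]] : exists z, [/\ x != y, x != z, y != z & tricycle x y z \in G].
  by case/linkedP: (all_l x y) xy => // ->; rewrite eqxx.
have [<- //|zv] := eqVneq z v.
have [w [_ zw vw Gw]] : exists w, [/\ z != v, z != w, v != w & tricycle z v w \in G].
  by case/linkedP: (all_l z v) zv => // ->; rewrite eqxx.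
have [zy zx vx vy] : [/\ z != y, z != x, v != x & v != y] by split; rewrite eq_sym.
have Gc := groupJ Gt Gw; rewrite tricycleJ in Gc.
have [xw|xw] := eqVneq x w.
  subst w; have := groupJ Gc Gw; rewrite tricycleJ.
  rewrite (tricycle1 zv vx) (tricycle3 zx vx) (tricycleD zy vy xy).
  rewrite (tricycle1 zv vx) (tricycle2 z v x) (tricycleD zy vy xy).
  by rewrite -groupV tricycleV tricycle_rot.
have [yw|yw] := eqVneq y w.
  have yx : y != x by rewrite eq_sym.
  subst w; have := groupJ Gc Gw; rewrite tricycleJ.
  rewrite (tricycle1 zv vy) (tricycle3 zy vy) (tricycleD zx vx yx).
  rewrite (tricycle1 zv vy) (tricycle2 z v y) (tricycleD zx vx yx).
  by rewrite -groupV tricycleV.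
by move: Gc; rewrite tricycle1 // !tricycleD // eq_sym.
Qed.

(** An even permutation is a product of pairs of transpositions. A pair with a common point is a
    3-cycle or trivial; between the members of any other pair, [tperm x z] is inserted twice. *)
Lemma Alt_sub_linked : (forall x y, linked x y) -> 'Alt_X \subset G.
Proof.
move=> all_l.
have share x y z : x != y -> x != z -> tperm x y * tperm x z \in G.
  move=> xy xz; have [->|yz] := eqVneq y z; first by rewrite tperm2 group1.
  exact: mem_tricycle.
have pair x y z v : x != y -> z != v -> tperm x y * tperm z v \in G.
  move=> xy zv; have [xz|xz] := eqVneq x z; first by rewrite -xz in zv *; apply: share.
  have -> : tperm x y * tperm z v = tperm x y * tperm x z * (tperm z x * tperm z v).
    by rewrite mulgA -(mulgA (tperm x y)) (tpermC z x) tperm2 mulg1.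
  by rewrite groupM ?share // eq_sym.
apply/fintype.subsetP=> s; rewrite Alt_even; have [ts -> ts_d] := prod_tpermP s.
have [n] := ubnP (size ts); elim: n ts ts_d => // n IHn [|[x y] [|[z v] ts]] /=.
- by rewrite big_nil group1.
- by case/andP=> xy _ _; rewrite big_seq1 odd_tperm xy.
case/and3P=> xy zv ts_d lt_n; rewrite !big_cons mulgA odd_permM => ev.
apply: groupM; first exact: pair.
apply: IHn => //; first by rewrite ltnS in lt_n; apply: leq_trans lt_n.
by move: ev; rewrite odd_permM !odd_tperm xy zv.
Qed.

(* A class of [linked] containing more than half of the points meets all its
   translates, hence is everything. *)
Lemma linked_large (C : {set X}) z :
  (forall x y, exists2 g, g \in G & g x = y) ->
  (forall x, x \in C -> linked z x) -> (#|X| < #|C| + #|C|)%N ->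
  forall x y, linked x y.
Proof.
move=> tr Cz ltX.
suff zl x : linked z x by move=> x y; apply: linked_trans (linked_sym _) (zl y).
have [g Gg <-] := tr z x.
suff [y Cy Cgy] : exists2 y, y \in C & y \in g @: C.
  apply: (linked_trans (Cz y Cy)).
  by case/imsetP: Cgy => v Cv ->; apply/linked_sym/linkedJ/Cz.
apply/fintype.exists_inP; apply: contraLR ltX => /fintype.exists_inPn dis.
rewrite -leqNgt -{2}(card_imset _ (@perm_inj _ g)) -cardsUI.
suff -> : C :&: g @: C = finset.set0 by rewrite cards0 addn0 max_card.
by apply/setP=> y; rewrite !inE; apply/andP=> -[/dis /negP].
Qed.

(* If w moves just one point z of the cycle P of a, then a^-1 * a ^ w is a
   3-cycle. *)
Lemma Alt_sub_of_cycle (P : {set X}) z (a w : {perm X}) :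
  (forall x y, exists2 g, g \in G & g x = y) ->
  a \in G -> w \in G -> (forall x, w (w x) = x) ->
  (forall y, y \notin P -> a y = y) -> w z \notin P -> a z != z ->
  (forall y, y \in P -> y != z -> w y = y) ->
  (forall y, y \in P -> exists i, y = (a ^+ i) z) ->
  (#|X| < #|P| + #|P|)%N -> 'Alt_X \subset G.
Proof.
move=> tr Ga Gw ww aP wz az wP aiP ltX; apply: Alt_sub_linked.
have Pz : z \in P by apply: contraNT az => /aP->.
have aPP y : y \in P -> a y \in P.
  by move=> Py; apply: contraLR Py => Pay; have /perm_inj <- := aP _ Pay.
have zaz : linked (a z) z.
  have Paz := aPP _ Pz.
  apply/linkedP; right; exists (w z); split=> //.
  - by apply: contraNneq wz => <-.
  - by apply: contraNneq wz => <-.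
  suff <- : a^-1 * a ^ w = tricycle (a z) z (w z) by rewrite groupM ?groupV ?groupJ.
  have ainvP y : y \in P -> a^-1 y \in P.
    by move=> Py; apply: contraLR (Py) => /[dup] /aP; rewrite permKV => <-.
  have waw y : (a ^ w) y = w (a (w y)).
    by rewrite -[in LHS](ww y) permJ.
  have az' : a^-1 z != z by rewrite -(inj_eq (@perm_inj _ a)) permKV eq_sym.
  have azwz : a z != w z by apply: contraNneq wz => <-.
  have zwz : z != w z by apply: contraNneq wz => <-.
  have ainvN y : y \notin P -> a^-1 y = y.
    by move=> Py; apply: (@perm_inj _ a); rewrite permKV aP.
  apply/permP=> y; rewrite permM waw.
  have [->|y_az] := eqVneq y (a z).
    by rewrite permK aP // ww tricycle1.
  have [->|y_z] := eqVneq y z.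
    by rewrite (wP (a^-1 z)) ?ainvP // permKV tricycle2.
  have [->|y_wz] := eqVneq y (w z).
    by rewrite ainvN // ww wP ?tricycle3.
  rewrite tricycleD 1?eq_sym //.
  have [Py|Py] := boolP (y \in P).
    rewrite (wP (a^-1 y)) ?ainvP ?permKV ?(wP y) //.
    by apply: contraNneq y_az => <-; rewrite permKV.
  rewrite ainvN // aP ?ww //.
  have [Pwy|//] := boolP (w y \in P).
  have [wyz|wyz] := eqVneq (w y) z; first by rewrite -wyz ww eqxx in y_wz.
  by have := Pwy; rewrite -(wP _ Pwy wyz) ww (negPf Py).
(* The powers of [a] carry the link between [z] and [a z] around [P], which therefore lies in one
   class. *)
apply: (linked_large tr _ ltX) => y Py.
have [i ->] := aiP y Py.
elim: i => [|i IHi]; first by rewrite expg0 perm1; apply: linked_refl.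
by apply: linked_trans IHi _; rewrite expgS permM linkedJ ?groupX // linked_sym.
Qed.
End Tricycles.

(** Conjugation by [a] inverts [a * b]. As [a] fixes [q], it sends the image of [q] under a power of
    [a * b] to its image under the inverse power. *)
Lemma dihedral_porbit (X : finType) (a b : {perm X}) q :
  a * a = 1 -> b * b = 1 -> a q = q ->
  forall y, y \in porbit (a * b) q ->
    a y \in porbit (a * b) q /\ b y \in porbit (a * b) q.
Proof.
move=> aa bb aq; set c := a * b.
have ca : c ^ a = c^-1.
  have aV : a^-1 = a by rewrite -[RHS]mulg1 -(mulgV a) mulgA aa mul1g.
  have bV : b^-1 = b by rewrite -[RHS]mulg1 -(mulgV b) mulgA bb mul1g.
  by rewrite conjgE aV /c !mulgA aa mul1g invMg aV bV.
have aP y : y \in porbit c q -> a y \in porbit c q.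
  case/porbitP=> i ->; rewrite -permM conjgC permM aq conjXg ca.
  by rewrite -porbitV mem_porbit.
move=> y /aP ayP; split=> //.
have -> : b y = c (a y) by rewrite -permM /c mulgA aa mul1g.
by case/porbitP: ayP => i ->; rewrite -permM -expgSr mem_porbit.
Qed.

Lemma dihedral_porbitr (X : finType) (a b : {perm X}) q :
  a * a = 1 -> b * b = 1 -> b q = q ->
  forall y, y \in porbit (a * b) q ->
    a y \in porbit (a * b) q /\ b y \in porbit (a * b) q.
Proof.
move=> aa bb bq y.
have aV : a^-1 = a by rewrite -[RHS]mulg1 -(mulgV a) mulgA aa mul1g.
have bV : b^-1 = b by rewrite -[RHS]mulg1 -(mulgV b) mulgA bb mul1g.
rewrite -porbitV invMg aV bV => yP.
by have [] := dihedral_porbit bb aa bq yP.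
Qed.

(* Raising c to a multiple k of r! with k = -1 modulo the length of the cycle P
   isolates the inverse of that cycle. *)
Lemma expg_cycle (X : finType) (c : {perm X}) (P : {set X}) q r k :
  porbit c q = P -> #|P| = k.+1 -> #|~: P| = r -> (r`! %| k)%N ->
  [/\ forall y, y \notin P -> (c ^+ k) y = y
    & forall y z, z \in P -> y \in P -> exists i, y = ((c ^+ k) ^+ i) z].
Proof.
move=> cP Pk Pr rk.
have full y : (c ^+ #|porbit c y|) y = y by rewrite permX iter_porbit.
have orbP y : y \in P -> porbit c y = P by rewrite -cP => yP; apply/eqP; rewrite eq_porbit_mem porbit_sym // porbit_sym.
split=> [y Py|y z zP yP].
  (* A cycle disjoint from [P] has length at most [r], so its length divides the factorial of [r],
     hence [k]. *)
  have /dvdnP[m ->] : (#|porbit c y| %| k)%N.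
    apply: dvdn_trans rk; apply: dvdn_fact; apply/andP; split.
      by apply/card_gt0P; exists y; apply: porbit_id.
    rewrite -Pr; apply/subset_leq_card/fintype.subsetP=> x xy.
    rewrite inE; apply: contra Py => /orbP <-; by rewrite porbit_sym.
  rewrite mulnC expgM; elim: m => [|m IHm]; first by rewrite perm1.
  by rewrite expgS permM full.
(* The cycle on [P] has length [k.+1], so there the power [k] is the inverse. *)
have ck x : x \in P -> (c ^+ k) x = c^-1 x.
  move=> xP; apply: (@perm_inj _ c); rewrite permKV -permM -expgSr -Pk -(orbP x xP).
  exact: full.
have ckP x : x \in P -> c^-1 x \in P.
  by rewrite -cP -porbitV => /porbitP[i ->]; rewrite -permM -expgSr mem_porbit.
have : y \in porbit c z by rewrite orbP.
rewrite -porbitV => /porbitP[i ->]; exists i.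
suff : ((c ^+ k) ^+ i) z = (c^-1 ^+ i) z /\ (c^-1 ^+ i) z \in P by case.
elim: i => [|i [IHi iP]]; first by rewrite !expg0 perm1.
by rewrite !expgSr !permM IHi ck ?ckP.
Qed.

(** * Conjugation of permutations by a bijection *)

Section PermTransport.
Context (X Y : finType) (h : X -> Y) (h' : Y -> X) (hK : cancel h h') (h'K : cancel h' h).

Lemma conj_perm_inj (s : {perm X}) : injective (fun y => h (s (h' y))).
Proof. by move=> y z /(can_inj hK)/perm_inj/(can_inj h'K). Qed.

Definition conj_perm (s : {perm X}) : {perm Y} := perm (@conj_perm_inj s).

Lemma conj_permM : {morph conj_perm : s s' / s * s'}.
Proof. by move=> s s'; apply/permP=> y; rewrite !permE /= !permE hK. Qed.

Lemma conj_perm_tperm x y : conj_perm (tperm x y) = tperm (h x) (h y).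
Proof.
apply/permP=> z; rewrite permE -[z in RHS]h'K.
by rewrite (inj_tperm _ _ _ (can_inj hK)).
Qed.

Lemma conj_perm1 : conj_perm 1 = 1.
Proof. by apply/permP=> z; rewrite permE !perm1 h'K. Qed.

Lemma odd_conj_perm s : odd_perm (conj_perm s) = odd_perm s.
Proof.
have [ts -> ts_d] := prod_tpermP s; elim: ts ts_d => [|[x y] ts IHts] /=.
  by rewrite big_nil conj_perm1 !odd_perm1.
case/andP=> xy /IHts IH; rewrite big_cons conj_permM !odd_permM IH.
by rewrite conj_perm_tperm !odd_tperm (inj_eq (can_inj hK)).
Qed.

End PermTransport.

(** An odd element of [G] yields every odd permutation as an even one times itself, so [G] is then
    the full symmetric group. Enumerating [X] moves the action to an ordinal. *)
Lemma alternating_or_symmetric (X : finType) (G : {group {perm X}}) :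
  'Alt_X \subset G -> alternating_group (subg_of G) \/ symmetric_group (subg_of G).
Proof.
move=> AG.
pose h := @enum_rank X; pose h' := @enum_val X X.
have hK : cancel h h' by exact: enum_rankK.
have h'K : cancel h' h by exact: enum_valK.
pose f (s : subg_of G) : {perm 'I_#|X|} := conj_perm hK h'K (sgval s).
have fM : {morph f : s s' / s * s'} by move=> s s'; rewrite /f /= conj_permM.
pose fm := isMultiplicative.Build (subg_of G) {perm 'I_#|X|} f fM.
pose F : {multiplicative (subg_of G) -> {perm 'I_#|X|}} := HB.pack f fm.
have Finj : injective F.
  move=> s s' /permP ss'; apply/val_inj/permP=> x; have := ss' (h x).
  by rewrite !permE hK => /(can_inj hK).
have Fsurj (p : {perm 'I_#|X|}) : conj_perm h'K hK p \in G -> exists s, F s = p.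
  move=> Gp; exists (subg G (conj_perm h'K hK p)); apply/permP=> y.
  by rewrite permE subgK //= permE !h'K.
have [GA|] := boolP (G \subset 'Alt_X).
  left; exists #|X|, F; split=> //; apply/predeqP => p; split=> /=.
    case=> s _ <-; rewrite Alt_even /= odd_conj_perm -Alt_even.
    exact: fintype.subsetP GA _ (subgP s).
  move=> Ap; have [|s <-] := Fsurj p; last by exists s.
  by apply: (fintype.subsetP AG); rewrite Alt_even odd_conj_perm -Alt_even.
case/subsetPn=> g Gg; rewrite Alt_even negbK => g_odd.
right; exists #|X|, F; split=> //; apply/predeqP => p; split=> /=; first by rewrite inE.
move=> _; have [|s <-] := Fsurj p; last by exists s.
set p' := conj_perm _ _ p.
have [p'_odd|p'_even] := boolP (odd_perm p').
  rewrite -(mulgKV g p') groupM //; apply: (fintype.subsetP AG).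
  by rewrite Alt_even odd_permM odd_permV p'_odd g_odd.
by apply: (fintype.subsetP AG); rewrite Alt_even.
Qed.
(** * Words in the Coxeter group *)

Lemma subgroupV (G : groupType) (H : classical_sets.set G) h :
  is_subgroup H -> H h -> H h^-1.
Proof. by case=> H1 HV /(HV _ _ H1); rewrite mul1g. Qed.

Lemma subgroupM (G : groupType) (H : classical_sets.set G) h h' :
  is_subgroup H -> H h -> H h' -> H (h * h').
Proof. by move=> [H1 HV] Hh /(HV _ _ H1)/(HV _ _ Hh); rewrite mul1g invgK. Qed.

Lemma multiplicative1 (G Q : groupType) (f : {multiplicative G -> Q}) : f 1 = 1.
Proof. by apply: (mulgI (f 1)); rewrite -gmulfM !mulg1. Qed.

Lemma multiplicativeV (G Q : groupType) (f : {multiplicative G -> Q}) g :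
  f g^-1 = (f g)^-1.
Proof. by apply: (mulgI (f g)); rewrite -gmulfM !mulgV multiplicative1. Qed.

Section CoxeterWords.
Context {I : finType} (e : rel I).

Notation W := (racg e).
Notation gen := (racg_gen e).

Lemma class_mul v w :
  word_class (racg_relators e) v * word_class _ w = word_class _ (v ++ w).
Proof. exact: presented_mulE. Qed.

Lemma class_cons a w : word_class (racg_relators e) (a :: w) =
  word_class (racg_relators e) [:: a] * word_class (racg_relators e) w :> W.
Proof. by rewrite class_mul. Qed.

Lemma gen_sq (i : I) : gen i * gen i = 1.
Proof.
rewrite class_mul; apply/word_classP.
by apply: WordRel; left; exists i.
Qed.

Lemma gen_inv (i : I) : (gen i)^-1 = gen i.
Proof. by rewrite -[LHS]mulg1 -(gen_sq i) mulgA mulVg mul1g. Qed.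

Lemma mulgenK (g : W) (i : I) : g * gen i * gen i = g.
Proof. by rewrite -mulgA gen_sq mulg1. Qed.

Lemma gen_comm (i j : I) : e i j -> gen i * gen j = gen j * gen i.
Proof.
move=> eij.
have inv k : word_class (racg_relators e) [:: (k, true)] = gen k :> W.
  by rewrite -[RHS]gen_inv [RHS]presented_invE.
have : word_class (racg_relators e) [:: (i, true); (j, true); (i, false); (j, false)]
    = 1 :> W.
  by apply/word_classP; apply: WordRel; right; exists i, j.
rewrite (class_cons (i, true)) (class_cons (j, true)) (class_cons (i, false)).
rewrite !inv -/(gen i) -/(gen j) => h; rewrite -[RHS]mul1g -h.
by rewrite -!mulgA (mulgA (gen j) (gen j)) gen_sq mul1g gen_sq mulg1.
Qed.

Definition wprod (w : seq I) : W := \prod_(i <- w) gen i.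

Lemma wprod_cons i w : wprod (i :: w) = gen i * wprod w.
Proof. by rewrite /wprod big_cons. Qed.

Lemma wprod_nil : wprod [::] = 1.
Proof. by rewrite /wprod big_nil. Qed.

Lemma wprod_surj (g : W) : exists w, wprod w = g.
Proof.
rewrite -[g]word_reprK; elim: (word_repr g) => [|[i b] r [w IHw]].
  by exists [::]; rewrite wprod_nil.
exists (i :: w); rewrite wprod_cons IHw.
rewrite class_cons.
congr (_ * _); case: b => //.
by rewrite -gen_inv [LHS]presented_invE.
Qed.

Lemma racg_hom (Q : groupType) (phi : I -> Q) :
  (forall i, phi i * phi i = 1) ->
  (forall i j, e i j -> phi i * phi j = phi j * phi i) ->
  exists f : {multiplicative W -> Q}, forall i, f (gen i) = phi i.
Proof.
move=> phi_sq phi_comm.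
pose ev (r : seq (I * bool)) : Q := \prod_(a <- r) phi a.1.
have ev_eq r r' : word_eq (racg_relators e) r r' -> ev r = ev r'.
  elim=> {r r'} [//|r r' _ -> //|r1 r2 r3 _ -> _ -> //|r1 r2 r3 r4 _ h _ h'|a|r].
  - by rewrite /ev !big_cat; congr (_ * _).
  - by rewrite /ev !big_cons !big_nil mulg1.
  case=> [[i ->]|[i [j [eij ->]]]]; rewrite /ev !big_cons !big_nil mulg1 //=.
  by rewrite mulgA {1}phi_comm // -!mulgA (mulgA (phi i)) phi_sq mul1g.
pose f (g : W) := ev (word_repr g).
have fM : {morph f : g h / g * h}.
  move=> g h; rewrite /f (ev_eq _ _ (word_reprP _ _)).
  by rewrite /ev big_cat.
have f1 : f 1 = 1 by rewrite /f (ev_eq _ _ (word_reprP _ _)) /ev big_nil.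
pose fm := isUMagmaMorphism.Build W Q f (conj f1 fM).
pose F : {multiplicative W -> Q} := HB.pack f fm.
exists F => i; rewrite /= /f (ev_eq _ _ (word_reprP _ _)).
by rewrite /ev big_cons big_nil mulg1.
Qed.

End CoxeterWords.
(** * Partial Schreier graphs *)

Section Charts.
Context {I : finType} {e : rel I} (e_sym : symmetric e) (e_irr : irreflexive e).
Context (H : classical_sets.set (racg e)) (H1 : H 1).

Notation W := (racg e).
Notation gen := (racg_gen e).

(* A finite piece of the Schreier graph of H: [act s] is an involution of the
   points, [dom s] marks the points carrying a genuine edge labelled s, and
   [lab x] represents the coset H * lab x. Outside [dom s] the involution
   [act s] is trivial: there the graph may still be extended. *)
Record chart := Chart {
  pt :> finType;
  act : I -> pt -> pt;
  dom : I -> pred pt;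
  lab : pt -> W;
  base : pt }.

Arguments act {c}.
Arguments dom {c}.
Arguments lab {c}.
Arguments base c : clear implicits.

Definition run (S : chart) (x : S) (w : seq I) : S := foldl (fun y s => act s y) x w.

Fixpoint dpath (S : chart) (x : S) (w : seq I) : bool :=
  if w is s :: w' then dom s x && dpath (act s x) w' else true.

Lemma run_cat (S : chart) (x : S) w w' : run x (w ++ w') = run (run x w) w'.
Proof. exact: foldl_cat. Qed.

Lemma dpath_cat (S : chart) (x : S) w w' :
  dpath x (w ++ w') = dpath x w && dpath (run x w) w'.
Proof. by elim: w x => //= s w IHw x; rewrite IHw andbA. Qed.

(** The fields [act_comm] and [dom_comm] express the closing of squares: an edge present or missing
    at a point stays so across an edge with a commuting label. *)
Record valid (S : chart) : Prop := Valid {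
  actK : forall s (x : S), act s (act s x) = x;
  act_out : forall s (x : S), ~~ dom s x -> act s x = x;
  act_comm : forall s t (x : S), e s t -> act s (act t x) = act t (act s x);
  dom_comm : forall s t (x : S), e s t -> dom s (act t x) = dom s x;
  lab_act : forall s (x : S), dom s x -> H (lab (act s x) * (lab x * gen s)^-1);
  chart_conn : forall x : S, exists w, dpath (base S) w && (run (base S) w == x) }.

(** Closed paths at the base point spell the conjugates of elements of [H] by the label of that
    point. *)
Definition loops (S : chart) : Prop :=
  forall h, H h -> exists w : seq I,
    [/\ dpath (base S) w, run (base S) w = base S
      & lab (base S) * wprod e w = h * lab (base S)].

Record extends (S S' : chart) (f : S -> S') : Prop := Extends {
  ext_base : f (base S) = base S';
  ext_lab : forall x, lab (f x) = lab x;
  ext_dom : forall s x, dom s x -> dom s (f x);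
  ext_act : forall s x, dom s x -> act s (f x) = f (act s x) }.

Lemma extends_id (S : chart) : extends (fun x : S => x).
Proof. by []. Qed.

Lemma extends_comp (S S' S'' : chart) (f : S -> S') (g : S' -> S'') :
  extends f -> extends g -> extends (fun x => g (f x)).
Proof.
move=> Ef Eg; split=> [|x|s x dx|s x dx]; first by rewrite (ext_base Ef) (ext_base Eg).
- by rewrite (ext_lab Eg) (ext_lab Ef).
- exact/(ext_dom Eg)/(ext_dom Ef).
- by rewrite (ext_act Eg) ?(ext_act Ef) //; apply: (ext_dom Ef).
Qed.

Lemma ext_dpath (S S' : chart) (f : S -> S') (x : S) w :
  extends f -> dpath x w -> dpath (f x) w /\ run (f x) w = f (run x w).
Proof.
move=> Ef; elim: w x => //= s w IHw x /andP[dx pw].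
by rewrite (ext_dom Ef) // (ext_act Ef) //; apply: IHw.
Qed.

Lemma ext_loops (S S' : chart) (f : S -> S') :
  extends f -> loops S -> loops S'.
Proof.
move=> Ef lS h /lS[w [dw rw lw]]; exists w.
have [] := ext_dpath Ef dw.
by rewrite rw (ext_base Ef) -(ext_base Ef) !(ext_lab Ef).
Qed.

(** * Adding a missing edge by doubling an orbit *)

Section Double.
Context (S : chart) (S_valid : valid S) (x0 : S) (u : I) (x0_free : ~~ dom u x0).

(** A new edge labelled [u] at [x0] forces, by closing squares, one at each of these points. *)
Definition orb : pred S :=
  connect (fun a b : S => [exists v, e u v && (b == act v a)]) x0.

Lemma orb_x0 : orb x0.
Proof. exact: connect0. Qed.

Lemma orb_act v y : e u v -> orb (act v y) = orb y.
Proof.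
have sub z : e u v -> orb z -> orb (act v z).
  move=> uv Oz; apply: connect_trans Oz (connect1 _).
  by apply/fintype.existsP; exists v; rewrite uv eqxx.
by move=> uv; apply/idP/idP; last exact: sub; move/(sub _ uv); rewrite actK.
Qed.

Lemma orb_dom y : orb y -> ~~ dom u y.
Proof.
move=> Oy; rewrite -(_ : dom u x0 = dom u y) //.
have /(_ (dom u)) := closed_connect _ Oy; apply=> a b.
case/fintype.existsP=> v /andP[uv /eqP->].
by change (dom u a = dom u (act v a)); rewrite dom_comm.
Qed.

Lemma orb_fix y : orb y -> act u y = y.
Proof. by move/orb_dom/(act_out S_valid). Qed.

Lemma orb_actu y : orb (act u y) = orb y.
Proof.
apply/idP/idP => [Oy|Oy]; last by rewrite orb_fix.
by have := orb_fix Oy; rewrite actK // => ->.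
Qed.

(** Only the orbit gets a second copy: [(y, true)] is the far end of the new edge labelled [u] at
    [y]. *)
Definition dpt : finType := {p : S * bool | p.2 ==> orb p.1}.

Definition raw_act s (p : S * bool) : S * bool :=
  if s == u then (act u p.1, p.2 (+) orb p.1)
  else if p.2 && ~~ e u s then p else (act s p.1, p.2).

Definition dact s (p : dpt) : dpt := insubd p (raw_act s (val p)).

Definition ddom s (p : dpt) : bool :=
  if s == u then orb (val p).1 || dom u (val p).1
  else ((val p).2 ==> e u s) && dom s (val p).1.

Definition dlab (p : dpt) : W :=
  if (val p).2 then lab (val p).1 * gen u else lab (val p).1.

Definition dinl (y : S) : dpt := exist _ (y, false) isT.

Definition dtop : dpt := exist _ (x0, true) orb_x0.

Definition double : chart := Chart dact ddom dlab (dinl (base S)).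

(** The default value of [insubd] in [dact] never matters, because [raw_act] preserves the condition
    that defines [dpt]. *)
Lemma val_dact s p : val (dact s p) = raw_act s (val p).
Proof.
rewrite val_insubd; case: p => -[y b] /= yb; case: ifP => //; case/negP.
rewrite /raw_act /=; case: ifP => [_|_] /=.
  by rewrite orb_actu; case: (orb y) b yb => [] [].
case: ifP => //= bus; case: b yb bus => //= Oy /negbFE us.
by rewrite orb_act.
Qed.

Lemma dactK s p : dact s (dact s p) = p.
Proof.
apply: val_inj; rewrite !val_dact; case: p => -[y b] /= yb; rewrite /raw_act.
have [_|su] := eqVneq s u => /=.
  by rewrite actK // orb_actu -addbA addbb addbF.
by case: b {yb} => /=; case us: (e u s); rewrite /= ?us ?actK.
Qed.

Lemma dact_out s p : ~~ ddom s p -> dact s p = p.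
Proof.
move=> nd; apply: val_inj; rewrite val_dact; case: p nd => -[y b] /= yb.
rewrite /ddom /raw_act /=; have [_|su] := eqVneq s u.
  by rewrite negb_or => /andP[/negPf -> /(act_out S_valid) ->]; rewrite addbF.
by case: b {yb} => //=; case: (e u s) => //= /(act_out S_valid) ->.
Qed.

Lemma neq_adj s t : e s t -> t != s.
Proof. by apply: contraTneq => ->; rewrite e_irr. Qed.

Lemma dact_comm s t p : e s t -> dact s (dact t p) = dact t (dact s p).
Proof.
move=> st; apply: val_inj; rewrite !val_dact; case: p => -[y b] /= yb.
have ts := neq_adj st; rewrite /raw_act.
have [su|su] := eqVneq s u; have [tu|tu] := eqVneq t u => /=.
- by rewrite su tu eqxx in ts.
- by subst s; rewrite st !andbF /= act_comm // orb_act.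
- subst t; have us : e u s by rewrite e_sym.
  by rewrite us !andbF /= act_comm // orb_act.
case us: (e u s); case ut: (e u t); case: b {yb} => /=; rewrite ?us ?ut //=;
  by rewrite act_comm.
Qed.

Lemma ddom_comm s t p : e s t -> ddom s (dact t p) = ddom s p.
Proof.
move=> st; rewrite /ddom val_dact; case: p => -[y b] /= yb.
have ts := neq_adj st; rewrite /raw_act.
have [su|su] := eqVneq s u; have [tu|tu] := eqVneq t u => /=.
- by rewrite su tu eqxx in ts.
- by subst s; rewrite st !andbF /= dom_comm // orb_act.
- by subst t; rewrite (e_sym u) st !implybT /= dom_comm.
by case: ifP => _ //=; rewrite dom_comm.
Qed.

Lemma dlab_act s p : ddom s p -> H (dlab (dact s p) * (dlab p * gen s)^-1).
Proof.
rewrite /ddom /dlab val_dact; case: p => -[y b] /= yb; rewrite /raw_act.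
have [->|su] := eqVneq s u => /=.
  have [Oy|nOy] := boolP (orb y); last first.
    case: b yb => /= [|_ dy]; first by rewrite (negPf nOy).
    exact: lab_act.
  by rewrite orb_fix //; case: b {yb} => /= _; rewrite ?mulgenK mulgV.
case: b {yb} => /= [|dy]; last exact: lab_act.
move=> /andP[us dy]; rewrite us /= -(mulgA (lab y)) (gen_comm us) (mulgA (lab y)).
by rewrite (invMg _ (gen u)) mulgA mulgK; apply: lab_act.
Qed.

Lemma dinl_extends : extends (S' := double) dinl.
Proof.
split=> //= s x dx; first by rewrite /ddom /= dx; case: eqP dx => // -> ->; rewrite orbT.
apply: val_inj; rewrite val_dact /raw_act /=; case: eqP dx => // -> dx.
by rewrite (contraTF (@orb_dom x)) // negbK.
Qed.

Lemma double_conn (p : double) : exists w, dpath (base double) w && (run (base double) w == p).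
Proof.
have inlP y : exists w, dpath (base double) w && (run (base double) w == dinl y).
  have [w /andP[dw /eqP rw]] := chart_conn S_valid y; exists w.
  have [] := ext_dpath dinl_extends dw; rewrite (ext_base dinl_extends) rw.
  by move=> -> ->; rewrite eqxx.
case: p => -[y [|]] yb; last first.
  by have [w] := inlP y; exists w; rewrite (_ : exist _ _ _ = dinl y) //; apply: val_inj.
have [w /andP[dw /eqP rw]] := inlP y; exists (rcons w u).
have Oy : orb y := yb.
rewrite -cats1 dpath_cat run_cat dw rw /= andbT {1}/ddom /= eqxx Oy /=.
by apply/eqP/val_inj; rewrite val_dact /raw_act /= eqxx Oy orb_fix.
Qed.

Lemma double_valid : valid double.
Proof.
split=> /=.
- exact: dactK.
- exact: dact_out.
- exact: dact_comm.
- exact: ddom_comm.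
- exact: dlab_act.
- exact: double_conn.
Qed.

Lemma dinl_neq_dtop y : dinl y != dtop.
Proof. by rewrite -val_eqE /= xpair_eqE andbF. Qed.

Lemma dinl_inj : injective dinl.
Proof. by move=> y z /(congr1 val) []. Qed.

Lemma ddom_dtop s : ddom s dtop = (s == u) || e u s && dom s x0.
Proof. by rewrite /ddom /= orb_x0; case: eqP. Qed.

Lemma dact_dtop : dact u dtop = dinl x0.
Proof. by apply: val_inj; rewrite val_dact /raw_act /= eqxx orb_x0 orb_fix // orb_x0. Qed.

Section Leaf.
Context (x0_leaf : forall v, e u v -> ~~ dom v x0).

(** Generators commuting with [u] all fix [x0], so doubling adds the single point [dtop], attached
    by one edge. *)
Lemma orb_leaf y : orb y = (y == x0).
Proof.
apply/idP/eqP => [Oy|->]; last exact: orb_x0.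
have fixx0 v : e u v -> act v x0 = x0 by move=> uv; apply/(act_out S_valid)/x0_leaf.
have /(_ (pred1 x0)) h := closed_connect _ Oy.
apply/eqP; have {h} := h _; rewrite !inE eqxx => <- // a b.
case/fintype.existsP=> v /andP[uv /eqP->]; rewrite !inE.
apply/eqP/eqP=> [->|]; first exact: fixx0.
by rewrite -{1}(fixx0 _ uv) => /(congr1 (act v)); rewrite !actK.
Qed.

Lemma leafP (p : double) : p = dtop \/ exists y, p = dinl y.
Proof.
case: p => -[y [|]] yb; [left | by right; exists y; apply: val_inj].
by apply: val_inj; have := yb; rewrite /= orb_leaf => /eqP->.
Qed.

Lemma leaf_act s y :
  dact s (dinl y) = if (s == u) && (y == x0) then dtop else dinl (act s y).
Proof.
apply: val_inj; rewrite val_dact /raw_act /= orb_leaf.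
have [->|su] /= := eqVneq s u; last by [].
by have [->|//] /= := eqVneq y x0; rewrite orb_fix ?orb_x0.
Qed.

Lemma leaf_dom s y : ddom s (dinl y) = (s == u) && (y == x0) || dom s y.
Proof. by rewrite /ddom /= orb_leaf; case: eqP => [->|]. Qed.

Lemma leaf_act_dtop s : s != u -> dact s dtop = dtop.
Proof.
move=> su; apply: val_inj; rewrite val_dact /raw_act /= (negPf su).
by case: ifP => //= /negbFE us; rewrite (act_out S_valid) ?x0_leaf.
Qed.

Lemma leaf_dom_dtop s : ddom s dtop = (s == u).
Proof.
rewrite ddom_dtop; case: eqP => //= _; apply/negP => /andP[us].
by apply/negP/x0_leaf.
Qed.

End Leaf.
End Double.


(** * Extensions over a connected complement graph *)

Section Extensions.
Context (gc_conn : graph_connected (complement_graph e)) (I_gt1 : (1 < #|I|)%N).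

Notation gc := (complement_graph e).

Lemma gc_sym u v : gc u v = gc v u.
Proof. by rewrite /complement_graph eq_sym e_sym. Qed.

Lemma gc_neq u v : gc u v -> u != v.
Proof. by case/andP. Qed.

Lemma gcN u v : gc u v -> ~~ e u v.
Proof. by case/andP. Qed.

Lemma gc_nbr u : exists v, gc u v.
Proof.
have [v uv] : exists v, u != v.
  have /card_gt1P[x [y [_ _ xy]]] := I_gt1.
  by have [ux|] := eqVneq u x; [exists y; rewrite ux | exists x].
have /connectP[[|z p] /=] := gc_conn u v; first by move=> _ vu; rewrite vu eqxx in uv.
by case/andP=> uz _ _; exists z.
Qed.

Definition incomplete (S : chart) : Prop := exists (x : S) u, ~~ dom u x.

(** The added point has no edge labelled by a neighbour of [u] in the complement graph, so the chart
    stays incomplete. *)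
Lemma extend_letter (S : chart) (x : S) u : valid S -> incomplete S ->
  exists (S' : chart) (f : S -> S'),
    [/\ valid S', incomplete S', extends f & dom u (f x)].
Proof.
move=> Sv Si; have [dx|dx] := boolP (dom u x).
  by exists S, id; split=> //; apply: extends_id.
exists (double x u), (dinl x u); split.
- exact: double_valid.
- have [v uv] := gc_nbr u; exists (dtop x u), v.
  by rewrite /= ddom_dtop negb_or negb_and gcN // orTb andbT eq_sym gc_neq.
- exact: dinl_extends.
- by rewrite /= /ddom eqxx orb_x0.
Qed.

Lemma extend_word (S : chart) (x : S) w : valid S -> incomplete S ->
  exists (S' : chart) (f : S -> S'),
    [/\ valid S', incomplete S', extends f & dpath (f x) w].
Proof.
elim: w S x => [|s w IHw] S x Sv Si.
  by exists S, id; split=> //; apply: extends_id.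
have [S1 [f1 [S1v S1i f1e d1]]] := extend_letter x s Sv Si.
have [S2 [f2 [S2v S2i f2e d2]]] := IHw S1 (act s (f1 x)) S1v S1i.
exists S2, (fun x => f2 (f1 x)); split=> //; first exact: extends_comp f1e f2e.
by rewrite /= (ext_dom f2e) // (ext_act f2e).
Qed.

Lemma extend_words (S : chart) (ws : seq (seq I)) : valid S -> incomplete S ->
  exists (S' : chart) (f : S -> S'),
    [/\ valid S', incomplete S', extends f & forall w, w \in ws -> dpath (base S') w].
Proof.
elim: ws S => [|w ws IHw] S Sv Si.
  by exists S, id; split=> //; apply: extends_id.
have [S1 [f1 [S1v S1i f1e d1]]] := extend_word (base S) w Sv Si.
have [S2 [f2 [S2v S2i f2e d2]]] := IHw S1 S1v S1i.
exists S2, (fun x => f2 (f1 x)); split=> //; first exact: extends_comp f1e f2e.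
move=> v; rewrite inE => /predU1P[->|/d2 //].
by have [] := ext_dpath f2e d1; rewrite (ext_base f1e) (ext_base f2e).
Qed.

(** Each step doubles at the point just created. The next letter does not commute with the current
    one, so it is free there, and the edge just added is not copied to the following point. *)
Lemma extend_walk (S : chart) (x : S) u p :
  valid S -> ~~ dom u x -> path gc u p ->
  exists (S' : chart) (f : S -> S') (z : S'),
    [/\ valid S', extends f, act (last u p) z != z
      & forall s, dom s z ->
          s = last u p \/ dom s x /\ forall v, v \in u :: p -> e v s].
Proof.
elim: p S x u => [|v p IHp] S x u Sv dx /=.
  move=> _; exists (double x u), (dinl x u), (dtop x u); split.
  - exact: double_valid.
  - exact: dinl_extends.
  - by rewrite /= dact_dtop // dinl_neq_dtop.
  move=> s; rewrite /= ddom_dtop => /orP[/eqP|/andP[us ds]]; [by left|right].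
  by split=> // v; rewrite inE => /eqP->.
case/andP=> uv vp.
have dv : ~~ dom v (dtop x u : double x u).
  by rewrite /= ddom_dtop negb_or negb_and gcN // orTb andbT eq_sym gc_neq.
have [S2 [f2 [z [S2v f2e zz dz]]]] := IHp _ _ v (double_valid Sv dx) dv vp.
exists S2, (fun y => f2 (dinl x u y)), z; split=> //.
  exact: extends_comp (dinl_extends Sv dx) f2e.
move=> s /dz[|[]]; [by left | rewrite /= ddom_dtop => ds vs; right].
have vse := vs v (mem_head _ _).
have us : s != u by apply: contraTneq vse => ->; rewrite e_sym gcN.
move: ds; rewrite (negPf us) /= => /andP[eus ds]; split=> // v'.
by rewrite inE => /predU1P[->|/vs].
Qed.

Lemma gc_cover (l : seq I) u w :
  exists p, [/\ path gc u p, last u p = w & {subset l <= u :: p}].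
Proof.
elim: l u => [|a l IHl] u.
  by have /connectP[p pp ->] := gc_conn u w; exists p.
have /connectP[p1 pp1 a1] := gc_conn u a.
have [p2 [pp2 l2 s2]] := IHl a.
exists (p1 ++ p2); rewrite cat_path last_cat pp1 -a1; split=> // v.
rewrite inE -cat_cons mem_cat => /predU1P[->|/s2]; first by rewrite a1 mem_last.
rewrite inE => /predU1P[->|->]; first by rewrite a1 mem_last.
by rewrite orbT.
Qed.

(* A generator active at the end of a walk through all of I would have to
   commute with itself, unless it is the last letter of the walk. *)
Lemma extend_pendant (S : chart) w : valid S -> incomplete S ->
  exists (S' : chart) (f : S -> S') (z : S'),
    [/\ valid S', extends f, act w z != z & forall s, dom s z -> s = w].
Proof.
move=> Sv [x [u dx]]; have [p [pp lp cov]] := gc_cover (enum I) u w.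
have [S' [f [z [S'v fe zz dz]]]] := extend_walk Sv dx pp.
rewrite lp in zz dz; exists S', f, z; split=> // s /dz[//|[_ /(_ s)]].
by rewrite e_irr cov ?mem_enum // => /(_ isT).
Qed.

Section Tail.
Context (w t u : I) (wt : gc w t) (tu : gc t u) (uw : u != w).

(* P is an orbit of the dihedral group generated by t and u: a path of k edges
   labelled t, u, t, ... from z to q, where an edge labelled c can be added. *)
Record tail (r k : nat) (S : chart) (z q : S) (P : {set S}) (c : I) : Prop := Tail {
  tl_valid : valid S;
  tl_z : z \in P;
  tl_wz : act w z \notin P;
  tl_w : forall y, y \in P -> y != z -> ~~ dom w y;
  tl_t : forall y, y \in P -> act t y \in P;
  tl_u : forall y, y \in P -> act u y \in P;
  tl_q : q \in P;
  tl_c : c = t \/ c = u;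
  tl_free : ~~ dom c q;
  tl_leaf : forall v, e c v -> ~~ dom v q;
  tl_gen : forall C : {set S}, q \in C ->
    (forall y, y \in C -> act t y \in C /\ act u y \in C) -> P \subset C;
  tl_card : #|P| = k.+1;
  tl_cardC : #|~: P| = r }.

(** The tail starts as the single point [z]. Its only edge is labelled [w], which differs from [t]
    and [u] and does not commute with [t]. *)
Lemma tail0 (S : chart) (z : S) : valid S -> act w z != z ->
  (forall s, dom s z -> s = w) -> tail #|~: [set z]%SET| 0 z z [set z]%SET t.
Proof.
move=> Sv zz dz.
have dN s : s != w -> ~~ dom s z by apply: contraNN => /dz->.
have tw : t != w by rewrite eq_sym gc_neq.
split=> //; rewrite ?inE ?cards1 //; try by [left | apply: dN].
- by move=> y; rewrite inE => /eqP->; rewrite eqxx.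
- by move=> y; rewrite !inE => /eqP->; rewrite (act_out Sv) ?dN.
- by move=> y; rewrite !inE => /eqP->; rewrite (act_out Sv) ?dN.
- by move=> v tv; apply: dN; apply: contraTneq tv => ->; rewrite e_sym gcN.
- by move=> C zC _; rewrite finset.sub1set.
Qed.

(** Doubling at the end [q] adds one point, whose only edge is labelled [c]. The other letter [d] of
    the pair [t], [u] does not commute with [c], so the tail can grow again. *)
Lemma tailS r k (S : chart) (z q : S) (P : {set S}) c : tail r k z q P c ->
  exists (S' : chart) (f : S -> S') (z' q' : S') (P' : {set S'}) (c' : I),
    extends f /\ tail r k.+1 z' q' P' c'.
Proof.
case=> Sv Pz wz Pw Pt Pu Pq cE cq qleaf Pgen Pk Pr.
pose d := if c == t then u else t.
have ut : u != t by rewrite eq_sym gc_neq.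
have [dE cdc dc wc ec] : [/\ d = t \/ d = u, [set t; u]%SET = [set c; d]%SET, d != c, w != c & ~~ e d c].
  rewrite /d; case: cE => ->; rewrite ?eqxx ?(negPf ut).
    by split; rewrite ?gc_neq // ?[e u t]e_sym ?gcN //; right.
  split; rewrite ?gcN // 1?eq_sym //; [by left|exact: finset.setUC].
pose f := dinl q c; pose q' := dtop q c.
have actE s y : act s (f y : double q c) =
    if (s == c) && (y == q) then q' else f (act s y).
  exact: leaf_act.
have cqq : act c q = q by apply: act_out.
have actq' s : act s (q' : double q c) = if s == c then f q else q'.
  by case: eqP => [->|/eqP sc]; [exact: dact_dtop | exact: leaf_act_dtop].
pose P' : {set double q c} := (q' |: f @: P)%SET.
have q'P : q' \notin [set f y | y in P]%SET.
  by apply/imsetP => -[y _ /eqP]; rewrite eq_sym (negPf (dinl_neq_dtop _ _ _)).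
have fP y : (f y \in P') = (y \in P).
  rewrite /P' !inE (negPf (dinl_neq_dtop _ _ _)) /=.
  by rewrite mem_imset //; apply: dinl_inj.
have P'act s y : (forall y, y \in P -> act s y \in P) -> y \in P' -> act s y \in P'.
  move=> Ps; rewrite {1}/P' in_setU1 => /predU1P[->|/imsetP[x Px ->]].
    by rewrite actq'; case: ifP; rewrite ?fP // /P' setU11.
  by rewrite actE; case: ifP => _; rewrite ?fP ?Ps // /P' setU11.
exists (double q c), f, (f z), q', P', d; split; first exact: dinl_extends.
split=> //.
- exact: double_valid.
- by rewrite fP.
- by rewrite actE (negPf wc) fP.
- move=> y; rewrite {1}/P' in_setU1 => /predU1P[->|/imsetP[x Px ->]].
    by rewrite /= leaf_dom_dtop.
  rewrite (inj_eq (@dinl_inj _ _ _)) => xz.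
  by rewrite /= leaf_dom // (negPf wc) /= Pw.
- by move=> y; apply: P'act.
- by move=> y; apply: P'act.
- by rewrite /P' setU11.
- by rewrite /= leaf_dom_dtop.
- by move=> v dv; rewrite /= leaf_dom_dtop //; apply: contraTneq dv => ->.
- move=> C q'C Cact.
  have Cc s y : s \in [set c; d]%SET -> y \in C -> act s y \in C.
    by rewrite -cdc !inE => /orP[]/eqP-> /Cact[].
  have fqC : f q \in C by have := Cc c q'; rewrite actq' eqxx !inE eqxx; apply.
  have : P \subset f @^-1: C.
    apply: Pgen => [|y]; first by rewrite inE.
    rewrite !inE => yC.
    have step s : s \in [set c; d]%SET -> f (act s y) \in C.
      move=> scd; have := Cc _ _ scd yC; rewrite actE.
      by case: ifP => // /andP[/eqP-> /eqP->]; rewrite cqq.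
    by split; apply: step; rewrite -cdc !inE eqxx ?orbT.
  move=> /fintype.subsetP PC; apply/fintype.subsetP=> y.
  rewrite /P' in_setU1 => /predU1P[->//|/imsetP[x /PC]].
  by rewrite inE => fx ->.
- by rewrite /P' cardsU1 q'P /= card_imset ?Pk //; apply: dinl_inj.
(* The only new point lies in [P'], so the complement keeps its size [r]. *)
rewrite -Pr -(card_imset _ (@dinl_inj _ q c)); apply: eq_card => y.
have [->|[x ->]] := leafP Sv qleaf y.
  rewrite !inE eqxx /=; apply/esym/negP => /imsetP[x _ /eqP].
  by rewrite eq_sym (negPf (dinl_neq_dtop _ _ _)).
by rewrite mem_imset ?inE -1?[_ || _]in_setU1 ?fP //; apply: dinl_inj.
Qed.

(** The number [r] of points off the tail is fixed before the length [k], which can thus be chosen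
    in terms of [r]. *)
Lemma extend_tail (S : chart) : valid S -> incomplete S ->
  exists r, forall k, exists (S' : chart) (f : S -> S') (z q : S') (P : {set S'}) (c : I),
    extends f /\ tail r k z q P c.
Proof.
move=> Sv Si; have [S0 [f0 [z [S0v f0e zz dz]]]] := extend_pendant w Sv Si.
exists #|~: [set z]%SET|; elim=> [|k' [S1 [f1 [z1 [q [P [c [f1e tl]]]]]]]].
  by exists S0, f0, z, z, [set z]%SET, t; split=> //; apply: tail0.
have [S2 [f2 [z2 [q2 [P2 [c2 [f2e tl2]]]]]]] := tailS tl.
exists S2, (fun x => f2 (f1 x)), z2, q2, P2, c2; split=> //.
exact: extends_comp f1e f2e.
Qed.

End Tail.
End Extensions.
End Charts.

(** * The permutation group of a chart *)

Section Monodromy.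
Context {I : finType} {e : rel I} (H : classical_sets.set (racg e)).
Context (H_sub : is_subgroup H).
Context (S : chart (e := e)) (S_valid : valid H S) (S_loops : loops H S).

Lemma act_inj s : injective (@act _ _ S s).
Proof. exact: can_inj (actK S_valid s). Qed.

Definition act_perm s : {perm S} := perm (@act_inj s).

Lemma act_permE s x : act_perm s x = act s x.
Proof. exact: permE. Qed.

Lemma act_perm_sq s : act_perm s * act_perm s = 1.
Proof. by apply/permP=> x; rewrite permM !act_permE perm1 (actK S_valid). Qed.

Lemma monodromy_exists :
  exists F : {multiplicative racg e -> {perm S}}, forall s, F (racg_gen e s) = act_perm s.
Proof.
apply: racg_hom => [|s t st]; first exact: act_perm_sq.
by apply/permP=> x; rewrite !permM !act_permE -(act_comm S_valid _ st).
Qed.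

Context (F : {multiplicative racg e -> {perm S}}).
Context (F_gen : forall s, F (racg_gen e s) = act_perm s).

Lemma monodromy_run w (x : S) : F (wprod e w) x = run x w.
Proof.
elim: w x => [|s w IHw] x; first by rewrite wprod_nil multiplicative1 perm1.
by rewrite wprod_cons gmulfM permM F_gen act_permE IHw.
Qed.

Definition image_set : {set {perm S}} := [set p | `[< exists g, F g = p >]]%SET.

Lemma image_setP p : reflect (exists g, F g = p) (p \in image_set).
Proof. by rewrite inE; apply: asboolP. Qed.

Lemma image_group_set : group_set image_set.
Proof.
apply/group_setP; split; first by apply/image_setP; exists 1; rewrite multiplicative1.
move=> p q /image_setP[g <-] /image_setP[h <-].
by apply/image_setP; exists (g * h); rewrite gmulfM.
Qed.

Definition image_group : {group {perm S}} := Group image_group_set.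

Lemma image_trans (x y : S) : exists2 p, p \in image_group & p x = y.
Proof.
have [v /andP[_ /eqP rv]] := chart_conn S_valid x.
have [w /andP[_ /eqP rw]] := chart_conn S_valid y.
exists (F ((wprod e v)^-1 * wprod e w)); first by apply/image_setP; eexists.
rewrite gmulfM multiplicativeV permM -rv -monodromy_run permK.
by rewrite monodromy_run.
Qed.

Lemma lab_run w (x : S) : dpath x w -> H (lab (run x w) * (lab x * wprod e w)^-1).
Proof.
elim: w x => [|s w IHw] x /=; first by rewrite wprod_nil mulg1 mulgV; case: H_sub.
case/andP=> dx /IHw Hw; rewrite wprod_cons.
have := subgroupM H_sub Hw (lab_act S_valid dx).
by rewrite !invMg -!mulgA mulKg.
Qed.

(** If [F h = F g], the path [w] closes up at the base point just as the loop of [h] does. Comparing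
    labels along it puts [g] in [H]. *)
Lemma monodromy_separates g w : ~ H g -> dpath (base S) w ->
  lab (base S) * wprod e w = g * lab (base S) -> forall h, H h -> F h <> F g.
Proof.
set y := lab (base S).
move=> Hg dw wE h Hh Fhg; apply: Hg.
have [v [dv rv vE]] := S_loops Hh.
have conjE a x : y * wprod e x = a * y -> wprod e x = y^-1 * a * y.
  by move=> xE; rewrite -mulgA -xE mulKg.
have rw : run (base S) w = base S.
  rewrite -monodromy_run (conjE g) // !gmulfM -Fhg -!gmulfM -(conjE h v) //.
  by rewrite monodromy_run.
have := lab_run dw; rewrite rw -/y wE invMg mulKVg => HgV.
by rewrite -[g]invgK; apply: subgroupV.
Qed.

Lemma range_image :
  exists f : {multiplicative racg e -> subg_of image_group},
    (forall g, sgval (f g) = F g) /\ range f = [set: subg_of image_group]%classic.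
Proof.
have FG g : F g \in image_group by apply/image_setP; exists g.
pose f g : subg_of image_group := subg image_group (F g).
have fE g : sgval (f g) = F g by rewrite subgK.
have fM : {morph f : g h / g * h}.
  by move=> g h; apply: val_inj; rewrite /= fE gmulfM -!fE.
pose fm := isMultiplicative.Build (racg e) (subg_of image_group) f fM.
pose f' : {multiplicative racg e -> subg_of image_group} := HB.pack f fm.
exists f'; split=> //.
apply/predeqP => p; split=> // _; have /image_setP[g gE] := subgP p.
by exists g => //; apply: val_inj; rewrite /= fE.
Qed.

(** By [expg_cycle], the power [k] of the product of [t] and [u] is one cycle on [P] and trivial
    elsewhere, while [w] moves only [z] within [P], and out of it. As [r < k], the set [P] is more
    than half of the chart. *)
Lemma image_Alt w t u r k (z q : S) P c :
  tail H w t u r k z q P c -> (r`! %| k)%N -> (r + 1 < k)%N ->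
  'Alt_S \subset image_group.
Proof.
move=> [_ Pz wz Pw Pt Pu Pq cE cq _ Pgen Pk Pr] rk kr.
pose a := act_perm t * act_perm u.
have aP y : y \in porbit a q ->
    act_perm t y \in porbit a q /\ act_perm u y \in porbit a q.
  have cqq : act_perm c q = q by rewrite act_permE (act_out S_valid).
  have [att auu] := (act_perm_sq t, act_perm_sq u).
  by case: cE cqq => -> cqq; [apply: dihedral_porbit | apply: dihedral_porbitr].
(* The orbit is stable under both involutions because one of them, [c], fixes [q]; and [P] is the
   smallest such set through [q]. *)
have orbP : porbit a q = P.
  apply/eqP; rewrite finset.eqEsubset; apply/andP; split.
    apply/fintype.subsetP=> y /porbitP[i ->]; elim: i => [|i IHi].
      by rewrite expg0 perm1.
    by rewrite expgSr permM /a permM !act_permE Pu ?Pt.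
  by apply: Pgen => [|y /aP]; rewrite ?porbit_id // !act_permE.
have [akN akP] := expg_cycle orbP Pk Pr rk.
have Fi s : act_perm s \in image_group by apply/image_setP; exists (racg_gen e s).
apply: (@Alt_sub_of_cycle _ image_group P z (a ^+ k) (act_perm w)).
- exact: image_trans.
- by rewrite groupX // groupM.
- exact: Fi.
- by move=> x; rewrite !act_permE (actK S_valid).
- exact: akN.
- by rewrite act_permE.
(* A fixed point [z] would reduce the cycle [P] to one point, against [k > 0]. *)
- apply/eqP=> az; suff : P \subset [set z]%SET.
    by move/subset_leq_card; rewrite cards1 Pk ltnS leqn0; case: (k) kr.
  apply/fintype.subsetP=> y /(akP _ _ Pz)[i ->]; rewrite inE.
  by elim: i => [|i /eqP IHi]; rewrite ?expg0 ?perm1 // expgSr permM IHi az.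
- by move=> y Py yz; rewrite act_permE (act_out S_valid) ?Pw.
- by move=> y Py; apply: akP.
by rewrite -[X in (X < _)%N](cardsC P) Pk Pr ltn_add2l ltnS (leq_trans (leq_addr 1 r) (ltnW kr)).
Qed.

End Monodromy.

Local Open Scope classical_set_scope.

(** * The quotient by [H] of a set closed under completing squares *)

Section SchreierChart.
Context {I : finType} {e : rel I} (H V : set (racg e)).
Context (H_sub : is_subgroup H).

Notation W := (racg e).
Notation gen := (racg_gen e).

Context (V_H : forall h v, H h -> V v -> V (h * v)).
Context (V_square : forall v s t,
  e s t -> V v -> V (v * gen s) -> V (v * gen t) -> V (v * gen s * gen t)).

Fixpoint vpath (v : W) (w : seq I) : Prop :=
  if w is s :: w' then V (v * gen s) /\ vpath (v * gen s) w' else True.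

Context (V_conn : forall v v', V v -> V v' -> exists w, vpath v w /\ v * wprod e w = v').

(** The choice depends only on the set of translates of [v] by [H], so it is constant on orbits.
    That set contains [v], and the default [1] never serves. *)
Definition orbit_rep (v : W) : W := xget 1 [set h * v | h in H].

Lemma orbit_repP v : exists2 h, H h & h * v = orbit_rep v.
Proof.
have [H1 _] := H_sub; apply: (@xgetPex _ 1 [set h * v | h in H]).
by exists v; exists 1; rewrite ?mul1g.
Qed.

Lemma orbit_repH h v : H h -> orbit_rep (h * v) = orbit_rep v.
Proof.
move=> Hh; have setE : [set k * (h * v) | k in H] = [set k * v | k in H].
  apply/predeqP => x; split=> -[k Hk <-].
    by exists (k * h); [exact: subgroupM | rewrite mulgA].
  exists (k * h^-1); first by apply: subgroupM => //; apply: subgroupV.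
  by rewrite mulgA mulgKV.
by rewrite /orbit_rep setE.
Qed.

Lemma V_HE h v : H h -> V (h * v) <-> V v.
Proof.
move=> Hh; split; last exact: V_H.
by move=> /(V_H (subgroupV H_sub Hh)); rewrite mulKg.
Qed.

Lemma V_rep v : V (orbit_rep v) <-> V v.
Proof. by have [h Hh <-] := orbit_repP v; apply: V_HE. Qed.

Lemma V_repM v g : V (orbit_rep v * g) <-> V (v * g).
Proof. by have [h Hh <-] := orbit_repP v; rewrite -mulgA; apply: V_HE. Qed.

Lemma orbit_repM v g : orbit_rep (orbit_rep v * g) = orbit_rep (v * g).
Proof. by have [h Hh <-] := orbit_repP v; rewrite -mulgA; apply: orbit_repH. Qed.

Lemma orbit_repK v : orbit_rep (orbit_rep v) = orbit_rep v.
Proof. by have := orbit_repM v 1; rewrite !mulg1. Qed.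

Context (v0 : W) (V_v0 : V v0) (reps : seq W).
Context (repsP : [set orbit_rep v | v in V] = [set` reps]).

Lemma mem_reps v : V v -> orbit_rep v \in reps.
Proof. by move=> Vv; have : [set` reps] (orbit_rep v); [rewrite -repsP; exists v|]. Qed.

Definition coset_base : seq_sub reps := SeqSub (mem_reps V_v0).

Definition coset_of (v : W) : seq_sub reps := insubd coset_base (orbit_rep v).

Lemma val_coset v : V v -> val (coset_of v) = orbit_rep v.
Proof. by move=> Vv; rewrite val_insubd mem_reps. Qed.

Lemma coset_eq v v' : V v -> V v' -> orbit_rep v = orbit_rep v' -> coset_of v = coset_of v'.
Proof. by move=> Vv Vv' vv'; rewrite /coset_of vv'. Qed.

Lemma coset_surj x : exists2 v, V v & x = coset_of v.
Proof.
have : [set` reps] (val x) by exact: valP.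
rewrite -repsP => -[v Vv vx]; exists v => //.
by apply: val_inj; rewrite val_coset.
Qed.

Lemma coset_base_eq : coset_base = coset_of v0.
Proof. by apply: val_inj; rewrite val_coset. Qed.

Definition coset_act s (x : seq_sub reps) : seq_sub reps :=
  if `[< V (val x * gen s) >] then coset_of (val x * gen s) else x.

Definition coset_dom s (x : seq_sub reps) : bool := `[< V (val x * gen s) >].

Definition schreier_chart : chart (e := e) :=
  Chart coset_act coset_dom val coset_base.

Lemma coset_domE s v : V v -> coset_dom s (coset_of v) = `[< V (v * gen s) >].
Proof.
move=> Vv; rewrite /coset_dom val_coset //; apply/asboolP/asboolP; by rewrite V_repM.
Qed.

Lemma coset_actE s v : V v -> coset_act s (coset_of v) =
  if `[< V (v * gen s) >] then coset_of (v * gen s) else coset_of v.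
Proof.
move=> Vv; rewrite -(coset_domE s Vv) /coset_act -/(coset_dom s _) coset_domE //.
case: asboolP => // Vvs; rewrite val_coset //; apply: coset_eq => //.
  exact/V_repM.
exact: orbit_repM.
Qed.

(** The converse is the square condition read from the corner [v * gen s]. *)
Lemma V_squareN v s t : e s t -> V v -> V (v * gen s) ->
  V (v * gen s * gen t) <-> V (v * gen t).
Proof.
move=> st Vv Vvs; split=> [Vvst|]; last exact: V_square.
by have := V_square st Vvs; rewrite mulgenK => /(_ Vv Vvst).
Qed.

Lemma vpath_dpath v w : V v -> vpath v w ->
  dpath (S := schreier_chart) (coset_of v) w /\
  run (S := schreier_chart) (coset_of v) w = coset_of (v * wprod e w).
Proof.
elim: w v => [|s w IHw] v Vv /=; first by rewrite wprod_nil mulg1.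
case=> Vvs vw; rewrite coset_domE // coset_actE //.
by rewrite (asboolT Vvs) wprod_cons mulgA; apply: IHw.
Qed.

Lemma schreier_valid : symmetric e -> valid H schreier_chart.
Proof.
move=> e_sym; split=> /=.
- move=> s x; have [v Vv ->] := coset_surj x; rewrite coset_actE //.
  case: asboolP => Vvs; rewrite coset_actE //; last by rewrite (asboolF Vvs).
  by rewrite mulgenK (asboolT Vv).
- by move=> s x; rewrite /coset_dom /coset_act => /negPf ->.
- move=> s t x st; have [v Vv ->] := coset_surj x; rewrite !coset_actE //.
  have ts : e t s by rewrite e_sym.
  case: asboolP => Vvt; case: asboolP => Vvs; rewrite !coset_actE //.
  + rewrite (asboolT (V_square st Vv Vvs Vvt)) (asboolT (V_square ts Vv Vvt Vvs)).
    by rewrite -mulgA -(gen_comm st) mulgA.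
  + by rewrite (asboolT Vvt) asboolF // (V_squareN ts).
  + by rewrite (asboolT Vvs) asboolF // (V_squareN st).
  + by rewrite !asboolF.
- move=> s t x st; have [v Vv ->] := coset_surj x; rewrite !coset_actE //.
  have ts : e t s by rewrite e_sym.
  case: asboolP => Vvt; rewrite !coset_domE //.
  by apply/asboolP/asboolP; rewrite V_squareN.
- move=> s x; have [v Vv ->] := coset_surj x; rewrite coset_domE // => /asboolP Vvs.
  rewrite coset_actE // (asboolT Vvs) !val_coset //.
  have [h Hh <-] := orbit_repP v; have [h' Hh' <-] := orbit_repP (v * gen s).
  by rewrite -(mulgA h) invMg mulgA mulgK; apply: subgroupM => //; apply: subgroupV.
move=> x; have [v Vv ->] := coset_surj x.
have [w [vw wv]] := V_conn V_v0 Vv; exists w.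
have [] := vpath_dpath V_v0 vw; rewrite -coset_base_eq => -> ->.
by rewrite wv eqxx.
Qed.

(** A path inside [V] from [y] to [h * y] becomes closed in the quotient. *)
Lemma schreier_loops : loops H schreier_chart.
Proof.
move=> h Hh; set y := lab _.
have Vy : V y by apply/V_rep.
have by_ : coset_base = coset_of y.
  by apply: val_inj; rewrite val_coset //= orbit_repK.
have [w [vw wv]] := V_conn Vy (V_H Hh Vy).
exists w; split=> //=; have [] := vpath_dpath Vy vw; rewrite by_ // => _ ->.
rewrite wv; apply: coset_eq => //; first exact: V_H.
exact: orbit_repH.
Qed.

Lemma schreier_incomplete v s : V v -> ~ V (v * gen s) -> incomplete schreier_chart.
Proof.
by move=> Vv Vvs; exists (coset_of v), s; rewrite /= coset_domE //; apply/asboolP.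
Qed.

End SchreierChart.

(** * The Davis-Moussong complex *)

Section DavisMoussong.
Context {I : finType} {e : rel I} (e_irr : irreflexive e).

Notation W := (racg e).
Notation gen := (racg_gen e).
Notation K := (davis_moussong e).

Lemma swap_neq1 : tperm ord0 ord_max <> 1 :> {perm 'I_2}.
Proof. by move/permP => /(_ ord0); rewrite tpermL perm1. Qed.

(** All relators have even length. The parity separates a vertex from its neighbours and rules out
    triangles in the 1-skeleton. *)
Lemma racg_parity : exists f : {multiplicative W -> {perm 'I_2}},
  forall s, f (gen s) = tperm ord0 ord_max.
Proof. by apply: racg_hom => // s; apply: tperm2. Qed.

Lemma gen_inj s t : gen s = gen t -> s = t.
Proof.
have [f fE] : exists f : {multiplicative W -> {perm 'I_2}},
    forall i, f (gen i) = if i == s then tperm ord0 ord_max else 1.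
  by apply: racg_hom => [i|i j _]; do !case: eqP => _; rewrite ?mulg1 ?mul1g ?tperm2.
move/(congr1 f); rewrite !fE eqxx; case: eqP => // _.
by move/swap_neq1.
Qed.

Lemma mulgen_neq g s : g * gen s <> g.
Proof.
rewrite -[RHS]mulg1 => /mulgI; have [f fE] := racg_parity.
by move/(congr1 f); rewrite fE multiplicative1 => /swap_neq1.
Qed.

Lemma cube_vertices1 (g : W) s : cube_vertices g [set s]%SET = [set g; g * gen s].
Proof.
apply/predeqP => x; split=> /=.
  case=> P /=; rewrite finset.subset1 => /orP[]/eqP-> <-; first by right; rewrite big_set1.
  by left; rewrite big_set0 mulg1.
case=> ->; first by exists finset.set0; rewrite /= ?finset.sub0set // big_set0 mulg1.
by exists [set s]%SET; rewrite /= ?big_set1.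
Qed.

Lemma cube_vertices0 (g : W) : cube_vertices g finset.set0 = [set g].
Proof.
apply/predeqP => x; split=> /=.
  by case=> P /=; rewrite finset.subset0 => /eqP-> <-; rewrite big_set0 mulg1.
by move=> ->; exists finset.set0; rewrite /= ?finset.sub0set // big_set0 mulg1.
Qed.

Lemma vertex_cube g : K [set g].
Proof.
by exists g, finset.set0; rewrite cube_vertices0; split=> // i j; rewrite inE.
Qed.

Lemma edge_cube g s : K [set g; g * gen s].
Proof.
exists g, [set s]%SET; rewrite cube_vertices1; split=> // i j.
by rewrite !inE => /eqP-> /eqP->.
Qed.

Lemma skel_edgeP (x y : W) : reflect (exists s, y = x * gen s) (skel_edge K x y).
Proof.
apply: (iffP (asboolP _)) => [[xy [g [J [_ cE]]]]|[s ->]]; last first.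
  by split; [move=> h; apply: (@mulgen_neq x s) | apply: edge_cube].
have [J0|[s sJ]] := set_0Vmem J.
  have [gx gy] : [set g] x /\ [set g] y.
    by rewrite -(cube_vertices0 g) -J0 -cE; split; [left|right].
  by case: xy; rewrite gx gy.
(* The cube contains the distinct vertices [g] and [g * gen s], which must be [x] and [y] in some
   order. *)
have [gxy gsxy] : [set x; y] g /\ [set x; y] (g * gen s).
  rewrite cE; split.
    by exists finset.set0; rewrite /= ?finset.sub0set // big_set0 mulg1.
  by exists [set s]%SET; rewrite /= ?finset.sub1set // big_set1.
exists s; case: gxy gsxy => <-; case=> //.
- by move/mulgen_neq.
- by move=> <-; rewrite mulgenK.
- by move/mulgen_neq.
Qed.

Section ConvexSubcomplex.
Context (Y : set (set W)) (Y_convex : convex_subcomplex K Y).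

Definition vertices : set W := [set g | Y [set g]].

Lemma vertices_face c g : Y c -> c g -> vertices g.
Proof.
move=> Yc cg; have [[_ sub] _] := Y_convex.
by apply: (sub c) => //; [exact: vertex_cube | move=> _ ->].
Qed.

Lemma vertices_nonempty : Y !=set0 -> vertices !=set0.
Proof.
case=> c Yc; have [[YK _] _] := Y_convex.
have [g [J [_ cE]]] := YK _ Yc; exists g; apply: (vertices_face Yc).
by rewrite cE; exists finset.set0; rewrite /= ?finset.sub0set // big_set0 mulg1.
Qed.

(** The path through the fourth corner is geodesic: its ends differ because [s] and [t] do, and by
    parity they are not adjacent. *)
Lemma vertices_square v s t : e s t -> vertices v -> vertices (v * gen s) ->
  vertices (v * gen t) -> vertices (v * gen s * gen t).
Proof.
move=> st Vv Vvs Vvt; have [_ conv] := Y_convex.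
have vts : v * gen t = v * gen s * gen t * gen s.
  by rewrite -(mulgA v) (gen_comm st) mulgA mulgenK.
have [|_] := conv (v * gen s) [:: v * gen s * gen t; v * gen t] _ Vvs Vvt; last first.
  by rewrite /= => /andP[/asboolP Yc _]; apply: vertices_face Yc _; right.
split.
  by rewrite /= andbT; apply/andP; split; apply/skel_edgeP; [exists t|exists s].
case=> [|y [|? ?]] //=.
  move=> _ /mulgI/gen_inj ss; by rewrite ss e_irr in st.
rewrite andbT => /skel_edgeP[j ->] h.
have [f fE] := racg_parity.
move: h; rewrite -mulgA => /mulgI/(congr1 f); rewrite gmulfM !fE tperm2.
by move/esym/swap_neq1.
Qed.

Lemma vertices_conn v v' : vertices v -> vertices v' ->
  exists w, vpath vertices v w /\ v * wprod e w = v'.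
Proof.
move=> Vv Vv'; have [_ conv] := Y_convex.
have skel_path w g : path (skel_edge K) g (scanl (fun x s => x * gen s) g w) /\
    last g (scanl (fun x s => x * gen s) g w) = g * wprod e w.
  elim: w g => [|s w IHw] g /=; first by rewrite wprod_nil mulg1.
  have [pw lw] := IHw (g * gen s); rewrite pw lw wprod_cons mulgA; split=> //.
  by rewrite andbT; apply/skel_edgeP; exists s.
(* A path of least length is a geodesic, so convexity keeps it in [Y]. *)
pose good n := `[< exists p, [/\ path (skel_edge K) v p, last v p = v' & size p = n] >].
have ex_good : exists n, good n.
  have [w wE] := wprod_surj (v^-1 * v'); have [pw lw] := skel_path w v.
  exists (size (scanl (fun x s => x * gen s) v w)); apply/asboolP.
  by exists (scanl (fun x s => x * gen s) v w); split; rewrite // lw wE mulKVg.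
have [n /asboolP[p [pp lp <-]] min_p] := ex_minnP ex_good.
have [||Yv Yp] := conv v p _ Vv; last first.
- have {}Vv : vertices v by exact: Yv.
  elim: p v {Yv Vv' ex_good min_p conv skel_path good} pp lp Yp Vv => [|y p IHp] v /=.
    by move=> _ -> _ _; exists [::]; rewrite wprod_nil mulg1.
  case/andP=> /skel_edgeP[s ->] pp lp /andP[/asboolP Ye Yp] Vv.
  have Vvs : vertices (v * gen s) by apply: vertices_face Ye _; right.
  have [w [vw wE]] := IHp _ pp lp Yp Vvs.
  by exists (s :: w); rewrite wprod_cons mulgA.
- by rewrite lp.
split=> // q pq lq; apply: min_p; apply/asboolP; exists q; split=> //.
by rewrite lq.
Qed.

End ConvexSubcomplex.

Lemma translate_vertex h (g : W) : translate h [set g] = [set h * g].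
Proof. by rewrite /translate image_set1. Qed.

Lemma set1_inj (g g' : W) : [set g] = [set g'] -> g = g'.
Proof. by move=> gg; have : [set g'] g by rewrite -gg. Qed.

Lemma cocompact_reps (H : set W) (Y : set (set W)) :
  convex_subcomplex K Y -> cocompact_on K H Y ->
  exists D : set W, [/\ finite_set D, D `<=` vertices Y &
    forall v, vertices Y v -> exists h d, [/\ H h, D d & v = h * d]].
Proof.
move=> Yc [Z [Zc Zfin ZY Zcov]]; exists (vertices Z); split.
- apply: (@finite_preimage _ _ Z (fun g : W => [set g])) => //.
  by move=> g g' _ _; apply: set1_inj.
- by move=> g /ZY.
move=> v /Zcov[h [d [Hh Zd vE]]]; exists h, (h^-1 * v); split=> //; last by rewrite mulKVg.
rewrite /vertices /= -translate_vertex vE.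
suff -> : translate h^-1 (translate h d) = d by [].
apply/predeqP => x; split=> [[_ [y dy <-] <-]|dx]; first by rewrite mulKg.
by exists (h * x); [exists x | rewrite mulKg].
Qed.

(** Otherwise [V] is the whole group. Writing the inverse of [g] as [h * d] shows that the coset of
    [g] is that of the inverse of [d], so finitely many cosets remain. *)
Lemma infinite_index_boundary (H V D : set W) :
  is_subgroup H -> infinite_index H -> finite_set D -> V !=set0 ->
  (forall v, V v -> exists h d, [/\ H h, D d & v = h * d]) ->
  exists v s, V v /\ ~ V (v * gen s).
Proof.
move=> H_sub Hinf Dfin [v0 Vv0] Vcov; apply: contrapT => /forallNP Vall.
have V_closed w v : V v -> V (v * wprod e w).
  elim: w v => [|s w IHw] v Vv; first by rewrite wprod_nil mulg1.
  rewrite wprod_cons mulgA; apply: IHw.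
  have /forallNP/(_ s)/not_andP[//|] := Vall v.
  by move/contrapT.
apply: Hinf; apply: sub_finite_set (finite_image (fun d => translate d^-1 H) Dfin).
move=> _ [g _ <-].
have Vg : V g^-1.
  by have [w wE] := wprod_surj (v0^-1 * g^-1); rewrite -[g^-1](mulKVg v0) -wE; apply: V_closed.
have [h [d [Hh Dd gE]]] := Vcov _ Vg; exists d => //.
apply/predeqP => x; split=> -[k Hk <-].
  exists (h * k); first exact: subgroupM.
  by rewrite -[g]invgK gE invMg !mulgA mulgKV.
exists (h^-1 * k); first by apply: subgroupM => //; apply: subgroupV.
by rewrite -[g]invgK gE invMg !mulgA.
Qed.

End DavisMoussong.

(** * Separability over a connected complement graph *)

Section Separability.
Context {I : finType} {e : rel I} (e_sym : symmetric e) (e_irr : irreflexive e).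
Context (I_ge3 : (3 <= #|I|)%N) (gc_conn : graph_connected (complement_graph e)).

Notation W := (racg e).
Notation gc := (complement_graph e).

(** As there is a third vertex, connectedness gives an edge leaving the pair of ends of any edge. *)
Lemma gc_path3 : exists w t u, [/\ gc w t, gc t u & u != w].
Proof.
have [a _] : exists a : I, a \in I.
  by apply/card_gt0P; apply: leq_trans I_ge3.
have [b ab] := gc_nbr gc_conn (ltnW I_ge3) a.
have [x [y [xab yab xy]]] :
    exists x y, [/\ x \in [set a; b]%SET, y \notin [set a; b]%SET & gc x y].
  apply: contrapT => no; have : (#|I| <= #|[set a; b]%SET|)%N; last first.
    by rewrite cards2 leqNgt (leq_trans _ I_ge3) //; case: (a != b).
  rewrite -cardsT; apply/subset_leq_card/fintype.subsetP => c _.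
  have clo : closed gc (mem [set a; b]%SET).
    move=> x y xy; apply/idP/idP => [xab|yab]; apply: contrapT => /negP n.
      by apply: no; exists x, y.
    by apply: no; exists y, x; split=> //; rewrite gc_sym.
  by rewrite -[_ \in _](closed_connect clo (gc_conn a c)) /= !inE eqxx.
move: xab yab; rewrite !inE negb_or => /orP[]/eqP xE /andP[ya yb]; subst x.
  by exists b, a, y; split=> //; rewrite gc_sym.
by exists a, b, y.
Qed.

Lemma convex_cocompact_separable (H : set W) :
  is_subgroup H -> infinite_index H -> convex_cocompact H ->
  separable (fun Q => alternating_group Q \/ symmetric_group Q) H.
Proof.
move=> H_sub Hinf [Y [Y0 Yc YH Ycoc]] F Ffin FH.
pose V := vertices Y.
have V_H h v : H h -> V v -> V (h * v).
  by move=> Hh Vv; have := YH _ _ Hh Vv; rewrite translate_vertex.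
have [D [Dfin DV Dcov]] := cocompact_reps Yc Ycoc.
have [v0 Vv0] := vertices_nonempty Yc Y0.
have [v [s [Vv Vvs]]] := infinite_index_boundary H_sub Hinf Dfin (ex_intro V v0 Vv0) Dcov.
have [reps repsP] : exists reps : seq W, [set orbit_rep H v | v in V] = [set` reps].
  apply/finite_seqP; suff -> : [set orbit_rep H v | v in V] = [set orbit_rep H v | v in D].
    exact: finite_image.
  apply/predeqP => x; split=> [[_ /Dcov[h [d [Hh Dd ->]]] <-]|[d /DV Vd <-]]; last by exists d.
  by exists d; rewrite ?orbit_repH.
have sq := vertices_square e_irr Yc; have conn := vertices_conn Yc.
pose S0 := schreier_chart Vv0 repsP.
have S0v : valid H S0 by apply: schreier_valid.
have S0l : loops H S0 by apply: schreier_loops.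
have S0i : incomplete S0 by apply: schreier_incomplete Vv Vvs.
have [H1 _] := H_sub; have [sF FE] := (finite_seqP F).1 Ffin.
pose y := lab (base S0).
(* The base point has label [y], so [g] is traced from there as its conjugate by [y]. *)
pose word g := sval (cid (wprod_surj (y^-1 * (g * y)))).
have wordE g : y * wprod e (word g) = g * y.
  by rewrite /word; case: cid => w /= ->; rewrite mulKVg.
have [S1 [f1 [S1v S1i f1e S1w]]] :=
  extend_words e_sym e_irr H1 gc_conn (ltnW I_ge3) (map word sF) S0v S0i.
have [w [t [u [wt tu uw]]]] := gc_path3.
(* This length is divisible by the factorial of [r] and exceeds [r + 1], as [image_Alt] requires. *)
have [r /(_ (r`! * r.+2)%N)] := extend_tail e_sym e_irr H1 gc_conn wt tu uw S1v S1i.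
case=> S2 [f2 [z [q [P [c [f2e tl]]]]]].
have S2v := tl_valid tl.
have S2l : loops H S2 by apply: ext_loops f2e (ext_loops f1e S0l).
have [m mE] := monodromy_exists S2v.
have [f [fE f_range]] := range_image m.
exists (subg_of (image_group m)), f; split=> //.
  apply: alternating_or_symmetric; apply: (image_Alt mE tl).
  exact: dvdn_mulr.
  by rewrite addn1 -{1}[r.+2]mul1n leq_mul2r fact_gt0.
move=> g Fg [h Hh fhg].
have labE : lab (base S2) = y.
  by rewrite -(ext_base f2e) (ext_lab f2e) -(ext_base f1e) (ext_lab f1e).
have [] := @monodromy_separates _ _ _ H_sub _ S2v S2l _ mE g (word g) (FH _ Fg) _ _ h Hh.
- have dw : dpath (base S1) (word g).
    by apply: S1w; apply: map_f; move: Fg; rewrite FE.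
  by have [] := ext_dpath f2e dw; rewrite (ext_base f2e).
- by rewrite labE.
by rewrite -!fE fhg.
Qed.

End Separability.

(** * Disconnected complement graphs *)

Section Disconnected.
Context {I : finType} {e : rel I} (e_sym : symmetric e).

Notation W := (racg e).
Notation gen := (racg_gen e).
Notation gc := (complement_graph e).

Lemma gen_neq1 s : gen s <> 1.
Proof. by move=> gs; apply: (@mulgen_neq _ e 1 s); rewrite mul1g. Qed.

(** The reflections sending [x] to [-x] and to [1 - x] of the integers modulo [i + 2] compose to the
    translation by 1, whose order exceeds [i]. The other generators act trivially. *)
Lemma gen_pair_infinite a b i : a != b -> ~~ e a b -> (0 < i)%N ->
  (gen a * gen b) ^+ i <> 1.
Proof.
move=> ab nab i_gt0.
have inj_a : injective (fun x : 'I_i.+2 => - x)%R by apply: GRing.oppr_inj.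
have inj_b : injective (fun x : 'I_i.+2 => 1 - x)%R.
  by move=> x y /GRing.addrI/GRing.oppr_inj.
pose phi s := if s == a then perm inj_a else if s == b then perm inj_b else 1.
have ba : (b == a) = false by rewrite eq_sym (negPf ab).
have [s|s t st|f fE] := @racg_hom _ e {perm 'I_i.+2} phi.
- rewrite /phi; case: eqP => _; last case: eqP => _; last by rewrite mulg1.
    by apply/permP=> x; rewrite !permE /= !permE GRing.opprK.
  by apply/permP=> x; rewrite !permE /= !permE GRing.subKr.
- rewrite /phi; have [sa|_] := eqVneq s a; have [ta|_] := eqVneq t a => //.
  + have [tb|_] := eqVneq t b; last by rewrite mulg1 mul1g.
    by rewrite sa tb (negPf nab) in st.
  + have [sb|_] := eqVneq s b; last by rewrite mulg1 mul1g.
    by rewrite sb ta e_sym (negPf nab) in st.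
  + by have [sb|_] := eqVneq s b; have [tb|_] := eqVneq t b; rewrite ?mulg1 ?mul1g.
move/(congr1 f); rewrite multiplicative1.
have fX j : f ((gen a * gen b) ^+ j) = (perm inj_a * perm inj_b) ^+ j.
  elim: j => [|j IHj]; first by rewrite !expg0 multiplicative1.
  by rewrite !expgSr gmulfM IHj gmulfM !fE /phi !eqxx ba.
rewrite fX => /permP/(_ 0%R); rewrite perm1.
have -> j : ((perm inj_a * perm inj_b) ^+ j) 0%R = (j%:R)%R.
  elim: j => [|j IHj]; first by rewrite expg0 perm1.
  by rewrite expgSr permM IHj permM !permE GRing.opprK -GRing.natr1 GRing.addrC.
move/(congr1 val); rewrite Zp_nat /= modn_small; last by rewrite ltnS leqnSn.
by move=> i0; rewrite i0 in i_gt0.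
Qed.

Lemma trivial_infinite_index a b : a != b -> ~~ e a b ->
  infinite_index [set (1 : W)].
Proof.
move=> ab nab fin; apply: infinite_nat.
have := @finite_preimage _ _ _ (fun i => translate ((gen a * gen b) ^+ i) [set (1 : W)]) _ fin.
have tE g : translate g [set (1 : W)] = [set g] by rewrite translate_vertex mulg1.
move=> h; apply: sub_finite_set (h _).
  by move=> i _ /=; exists ((gen a * gen b) ^+ i).
have aux i j : (i < j)%N -> (gen a * gen b) ^+ i <> (gen a * gen b) ^+ j.
  move=> ij; rewrite -(subnKC (ltnW ij)) expgD -[LHS]mulg1 => /mulgI/esym.
  by apply: gen_pair_infinite; rewrite ?subn_gt0.
move=> i j _ _; rewrite !tE => /set1_inj ij.
by case: (ltngtP i j) => // /aux; rewrite ij.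
Qed.

Lemma trivial_convex_cocompact : convex_cocompact [set (1 : W)].
Proof.
have sub : subcomplex (davis_moussong e) [set [set (1 : W)]].
  split; first by move=> _ ->; apply: vertex_cube.
  move=> _ d -> [g [J [_ dE]]] d1 /=.
  have dg : d g by rewrite dE; exists finset.set0; rewrite /= ?finset.sub0set // big_set0 mulg1.
  apply/predeqP => x; split=> [/d1//|->].
  by rewrite -(d1 _ dg).
exists [set [set (1 : W)]]; split.
- by exists [set (1 : W)].
- split=> // x p [_ p_min] /set1_inj x1 /set1_inj p1.
  have := p_min [::] isT; rewrite /= p1 x1 => /(_ erefl).
  by rewrite leqn0 size_eq0 => /eqP->.
- by move=> _ _ -> ->; rewrite translate_vertex mulg1.
exists [set [set (1 : W)]]; split=> //.
by move=> _ ->; exists 1, [set 1]; split; rewrite // translate_vertex mulg1.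
Qed.

Lemma trivial_subgroup : is_subgroup [set (1 : W)].
Proof. by split=> // _ _ -> ->; rewrite /= mulgV. Qed.

(* p commutes with a 3-cycle that fixes x and moves p x. *)
Lemma cent_Alt_trivial (X : finType) (p : {perm X}) :
  (3 < #|X|)%N -> p \in 'C('Alt_X) -> p = 1.
Proof.
move=> X_gt3 /centP pC; apply/permP=> x; rewrite perm1; apply/eqP/negPn/negP => px.
have : (1 < #|~: [set x; p x]%SET|)%N.
  by rewrite -(leq_add2l #|[set x; p x]%SET|) cardsC cards2 eq_sym px.
case/card_gt1P=> y [z [Dy Dz yz]]; move: Dy Dz; rewrite !inE !negb_or.
case/andP=> yx yp /andP[zx zp].
have /pC/permP/(_ x) : tperm (p x) y * tperm (p x) z \in 'Alt_X.
  by rewrite Alt_even odd_permM !odd_tperm eq_sym yp eq_sym zp.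
rewrite !permM (tpermD _ yx) // (tpermD _ zx) // tpermL tpermD 1?eq_sym //.
by move=> E; rewrite E eqxx in yp.
Qed.

Lemma disconnected_not_separable a b k :
  a != b -> ~~ e a b -> ~~ connect gc a k ->
  ~ separable (fun Q => alternating_group Q \/ symmetric_group Q) [set (1 : W)].
Proof.
move=> ab nab ak sep; set c := gen a * gen b.
(* The bound 24 is the order of the symmetric group of degree 4: keeping these powers of [c]
   nontrivial forces degree at least 5, where the alternating group is simple. *)
pose F := gen k :: [seq c ^+ i | i <- iota 1 24].
have [||Q [f [QAS f_surj f_sep]]] := sep [set` F]; first exact: finite_seq.
  move=> _ /[swap] -> /=; rewrite inE => /predU1P[/esym/gen_neq1//|/mapP[i]].
  by rewrite mem_iota => /andP[i_gt0 _] /esym; apply: gen_pair_infinite.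
have {}f_sep g : g \in F -> f g <> 1.
  by move=> Fg fg; apply: (f_sep _ Fg); exists 1; rewrite // multiplicative1 fg.
have [n [psi [psi_inj psi_Alt]]] : exists n (psi : {multiplicative Q -> {perm 'I_n}}),
    injective psi /\ [set s | s \in 'Alt_('I_n)] `<=` range psi.
  case: QAS => -[n [psi [psi_inj psiE]]]; exists n, psi; split; rewrite // psiE //.
  by move=> s _; rewrite /= inE.
pose m g := psi (f g).
have mM g h : m (g * h) = m g * m h by rewrite /m !gmulfM.
have m1 : m 1 = 1 by rewrite /m !multiplicative1.
have mX g i : m (g ^+ i) = m g ^+ i.
  by elim: i => [|i IHi]; rewrite ?expg0 ?m1 // !expgSr mM IHi.
have m_neq1 g : g \in F -> m g != 1.
  move=> /f_sep fg; apply/eqP; rewrite -(multiplicative1 psi) => /psi_inj.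
  exact: fg.
have m_surj s : s \in 'Alt_('I_n) -> exists g, m g = s.
  move=> /psi_Alt[x _ <-]; have [g _ <-] : range f x by rewrite f_surj.
  by exists g.
have cX i : (0 < i <= 24)%N -> m c ^+ i != 1.
  move=> i24; rewrite -mX m_neq1 // inE; apply/orP; right; apply: map_f.
  by rewrite mem_iota.
have n_gt4 : (4 < n)%N.
  rewrite ltnNge; apply/negP => n4.
  have /cX : (0 < #[m c] <= 24)%N; last by rewrite expg_order eqxx.
  rewrite order_gt0 /=; apply: (@leq_trans #|'Sym_('I_n)|).
    by apply/subset_leq_card/fintype.subsetP => ?; rewrite inE.
  by rewrite card_Sym card_ord; case: n n4 {psi psi_inj psi_Alt m mM m1 mX m_neq1 m_surj cX} => [|[|[|[|[|]]]]].
(* Generators outside the component of [a] centralize [M], so the whole image normalizes it. *)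
pose M := <<[set m (gen s) | s in connect gc a]%SET>>%G.
have genM s : connect gc a s -> m (gen s) \in M.
  by move=> as_; apply/mem_gen/imset_f.
have genC s : ~~ connect gc a s -> m (gen s) \in 'C(M).
  move=> nas; rewrite /= cent_gen; apply/centP => _ /imsetP[t at_ ->].
  rewrite /commute -!mM gen_comm //; apply/negPn/negP => nst.
  move/negP: (nas); apply; apply: (connect_trans at_); apply: connect1.
  rewrite /complement_graph e_sym nst andbT.
  by apply: contraTneq at_ => ->.
have normM g : m g \in 'N(M).
  have [w <-] := wprod_surj g; elim: w => [|s w IHw]; first by rewrite wprod_nil m1 group1.
  rewrite wprod_cons mM groupM //; have [as_|nas] := boolP (connect gc a s).
    by apply: (fintype.subsetP (normG _)); apply: genM.
  by apply: (fintype.subsetP (cent_sub _)); apply: genC.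
have mcM : m c \in M.
  rewrite mM groupM ?genM //; apply: connect1.
  by rewrite /complement_graph ab nab.
(* The square of [m c] is even, nontrivial and in [M], so by simplicity the normal subgroup cut out
   by [M] is everything. *)
have AltM : 'Alt_('I_n) \subset M.
  have /simpleP[_ simp] : simple 'Alt_('I_n) by apply: simple_Alt5; rewrite card_ord.
  have : (M :&: 'Alt_('I_n))%G <| 'Alt_('I_n).
    rewrite /normal finset.subsetIr; apply/normsI; last exact: normG.
    by apply/fintype.subsetP => s /m_surj[g <-].
  case/simp => /= MA; last by rewrite -MA finset.subsetIl.
  have : m c ^+ 2 \in (M :&: 'Alt_('I_n))%SET.
    by rewrite inE groupX // Alt_even expgS expg1 odd_permM addbb.
  by rewrite MA inE (negPf (cX 2%N _)).
have := cent_Alt_trivial (p := m (gen k)).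
rewrite card_ord => /(_ (ltnW n_gt4)) h.
have : m (gen k) != 1 by apply: m_neq1; rewrite inE eqxx.
rewrite h ?eqxx //.
by apply: (fintype.subsetP (centS AltM)); apply: genC.
Qed.

End Disconnected.

(* Complete graphs are excluded: there C(G) = (Z/2)^n is finite, it has no
   infinite-index subgroup, and the complement graph is not connected. *)
Theorem lemmaB (I : finType) (e : rel I)
    (e_sym : symmetric e) (e_irr : irreflexive e) (I_ge3 : (3 <= #|I|)%N)
    (e_not_complete : exists i j : I, i <> j /\ ~~ e i j) :
  (forall H : set (racg e),
     is_subgroup H -> infinite_index H -> convex_cocompact H ->
     separable (fun Q => alternating_group Q \/ symmetric_group Q) H)
  <-> graph_connected (complement_graph e).
Proof.
split=> [sep|gc_conn H]; last exact: convex_cocompact_separable.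
have [a [b [/eqP ab nab]]] := e_not_complete.
(* The trivial subgroup has infinite index because [a] and [b] generate an infinite dihedral group;
   it serves as the test case. *)
have gc_a k : connect (complement_graph e) a k.
  apply: contrapT => /negP ak; apply: (disconnected_not_separable e_sym ab nab ak).
  apply: sep; [exact: trivial_subgroup | | exact: trivial_convex_cocompact].
  exact: trivial_infinite_index ab nab.
have gc_symm : connect_sym (complement_graph e).
  by apply: sym_connect_sym => i j; apply: gc_sym.
by move=> i j; apply: connect_trans (gc_a j); rewrite gc_symm.
Qed.
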